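(* Let $K$ be a field of characteristic different from $2$, let $\varphi$ be a quadratic form over $K$ and let $\psi$ be a quadratic form of odd dimension over $K$. Then $\mathbf{PSim}^+(\varphi\otimes\psi)$ is rationally connected if and only if $\mathbf{PSim}^+(\varphi)$ is rationally connected.
   Context: All quadratic forms are nondegenerate (and nonzero when the group below is formed). For a quadratic form $\varphi$ over $K$, $\mathbf{PSim}(\varphi)$ denotes the linear algebraic $K$-group of projective similitudes of $\varphi$ (the group of similitudes of $\varphi$ modulo the central multiplicative group $\mathbb{G}_m$), and $\mathbf{PSim}^+(\varphi)$ (the group of proper projective similitudes) is its connected component of the identity. A connected linear algebraic group $G$ over $K$ is called rationally connected (equivalently, $R$-trivial) if for every field extension $K'/K$ any two points of $G(K')$ are $R$-equivalent; $R$-equivalence on $G(K')$ is the equivalence relation generated by: $x\sim y$ if there is a $K'$-rational map $f:\mathbb{P}^1_{K'}\dashrightarrow G_{K'}$ defined at $0$ and $1$ with $f(0)=x$ and $f(1)=y$. *)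

(* Defs.v *)
From HB Require Import structures.
From Stdlib Require Import Relation_Operators.
From mathcomp Require Import all_boot all_order all_algebra.
From mathcomp Require Import boolp classical_sets topology_structure connected.
From mathcomp Require Export mxtens.
From mathcomp Require Import mpoly.

Set Implicit Arguments.
Unset Strict Implicit.
Unset Printing Implicit Defensive.

Import GRing.Theory.
Local Open Scope classical_set_scope.
Local Open Scope ring_scope.

(* In characteristic not 2, a nondegenerate quadratic form of dimension n is
   given by its Gram matrix; the tensor product of two forms then has as Gram
   matrix the Kronecker product [A *t B]. *)
Definition nondeg_qform (K : fieldType) (n : nat) (A : 'M[K]_n) : Prop :=
  A^T = A /\ A \in unitmx.

Definition qvalue (K : fieldType) (n : nat) (A : 'M[K]_n) (v : 'rV[K]_n) : K :=
  (v *m A *m v^T) 0 0.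

(* The matrix g stands for the endomorphism v |-> v *m g. *)
Definition similitude (K : fieldType) (n : nat) (A g : 'M[K]_n) : Prop :=
  g \in unitmx /\
  exists2 mu : K, mu != 0 & forall v, qvalue A (v *m g) = mu * qvalue A v.

(* Algebraic subgroups G of PGL_n over K, through their points over all
   extensions L / K.  By Hilbert 90 an L-point of PGL_n is the class, modulo
   L^*, of a matrix in GL_n(L); [G L i] is the set of all representatives of
   the L-points of G, so it is stable under L^*. *)
Definition proj_functor (K : fieldType) (n : nat) : Type :=
  forall L : fieldType, {rmorphism K -> L} -> set 'M[L]_n.

Definition PSim (K : fieldType) (n : nat) (A : 'M[K]_n) : proj_functor K n :=
  fun L i => [set g | similitude (map_mx i A) g].

(* Matrices with the topology generated by the nonvanishing loci of homogeneous
   polynomials in the entries.  On invertible matrices, this is the inverse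
   image of the Zariski topology of PGL_n(F), an open subset of the projective
   space of matrices. *)
Definition zariski_mx (F : fieldType) (n : nat) : Type := 'M[F]_n.

HB.instance Definition _ (F : fieldType) (n : nat) :=
  Choice.on (zariski_mx F n).

Definition zariski_basic_open (F : fieldType) (n : nat) :
    set (set (zariski_mx F n)) :=
  [set U | exists (d : nat) (p : {mpoly F[n * n]}), p \is d.-homog /\
     U = [set g : 'M[F]_n | p.@[fun k => mxvec g 0 k] != 0]].

HB.instance Definition _ (F : fieldType) (n : nat) :=
  isSubBaseTopological.Build (zariski_mx F n) (@zariski_basic_open F n) id.

(* The L-points of the connected component of the identity of G are the
   L-points that lie, over an algebraically closed extension of L, in the
   connected component of 1 for the Zariski topology. *)
Definition identity_component (K : fieldType) (n : nat)
    (G : proj_functor K n) : proj_functor K n :=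
  fun L i => [set g | G L i g /\
    exists (Omega : closedFieldType) (j : {rmorphism L -> Omega}),
      connected_component (G Omega (j \o i) : set (zariski_mx Omega n))
        (1%:M : 'M[Omega]_n) (map_mx j g)].

Definition PSim_plus (K : fieldType) (n : nat) (A : 'M[K]_n) :
    proj_functor K n :=
  identity_component (PSim A).

(* A rational map from the projective line to PGL_n over L is (the class of) an
   invertible matrix f over L(t).  It is defined at a with value the class of
   the invertible matrix g iff it has homogeneous coordinates that are
   polynomials and specialize to g at t = a. *)
Definition has_value_at (L : fieldType) (n : nat)
    (f : 'M[{fraction {poly L}}]_n) (a : L) (g : 'M[L]_n) : Prop :=
  exists2 c : {fraction {poly L}}, c != 0 &
  exists2 P : 'M[{poly L}]_n,
    c *: f = map_mx (@tofrac {poly L}) P & map_mx (horner_eval a) P = g.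

Definition R_link (K : fieldType) (n : nat) (G : proj_functor K n)
    (L : fieldType) (i : {rmorphism K -> L}) (x y : 'M[L]_n) : Prop :=
  [/\ G L i x, G L i y &
   exists f : 'M[{fraction {poly L}}]_n,
   [/\ G {fraction {poly L}} (@tofrac {poly L} \o (@polyC L \o i)) f,
       has_value_at f 0 x & has_value_at f 1 y]].

Definition R_equivalent (K : fieldType) (n : nat) (G : proj_functor K n)
    (L : fieldType) (i : {rmorphism K -> L}) : 'M[L]_n -> 'M[L]_n -> Prop :=
  clos_refl_sym_trans 'M[L]_n (R_link G i).

Definition rationally_connected (K : fieldType) (n : nat)
    (G : proj_functor K n) : Prop :=
  forall (L : fieldType) (i : {rmorphism K -> L}) (x y : 'M[L]_n),
    G L i x -> G L i y -> R_equivalent G i x y.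

(* Main.v *)
From HB Require Import structures.
From Stdlib Require Import Relation_Operators.
Require Import Defs.
From mathcomp Require Import all_boot all_order all_algebra.
From mathcomp Require Import generic_quotient ring_quotient closed_field.
From mathcomp Require Import finmap ring zify mpoly.
From mathcomp Require Import boolp classical_sets filter functions.
From mathcomp Require Import topology_structure connected.

Set Implicit Arguments.
Unset Strict Implicit.
Unset Printing Implicit Defensive.

Import GRing.Theory.
Local Open Scope ring_scope.

(** Why the theorem holds.  Over a field L containing K, let G(phi) be the group
    of multipliers of the similitudes of phi.  The plan is to show that whether
    PSim^+(phi) is rationally connected depends only on the functor sending L to
    G(phi_L), and then that phi and its tensor product with psi have the
    same multipliers over every L when the dimension of psi is odd.

    Up to a scalar, two proper similitudes with the same multiplier differ by a
    rotation, that is by a product of an even number of reflections (cartan_dieudonne).  When w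
    runs along the segment from u to v, the product of the reflections in u and
    in w joins 1 to the product of the reflections in u and in v; hence such
    similitudes are R-equivalent (chain_same_multiplier).  Now let a chain of
    R-links for phi join 1 to a similitude with multiplier c.  The multipliers
    along a link form a polynomial m(t), which is a multiplier of phi over L(t)
    and so of any form with the same multipliers.  This gives a similitude h of
    the second form over L(t) with multiplier m(t), but h may have poles at t = 0
    and t = 1.  Reflections over L(t) remove them (remove_pole, regularize), and
    the regular similitude links the required values of the multiplier
    (transfer_link, transfer_rationally_connected).

    For the equality of multipliers, c belongs to G(phi) if and only if phi is
    isometric to c phi, that is (1 - c) phi = 0 in the Witt ring, so it is enough
    that the class of an odd-dimensional form is not a zero divisor
    (odd_sum_regular).  If x y = 0 with y = <a_1> + ... + <a_m> and m odd, multiply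
    by factors 1 + <a> or 1 - <a>, for all entries a of x and y: each <a> then acts
    as a sign, so x and y act as integers, the second one odd.  What remains is an
    integer multiple of a Pfister form; as isotropic Pfister forms are hyperbolic,
    its vanishing forces the Pfister form to be killed by a power of 2.  Adding up
    over all signs, x is killed by a power of 2, and then x = 0 since y^2 = 1
    modulo 2.

    The identity component is defined by the Zariski topology over algebraically
    closed fields Omega containing L.  There, a path of similitudes is an
    irreducible set, which gives one inclusion between the component and the
    proper similitudes (proper_component), and the equations det = m^(n/2) and
    det = - m^(n/2) separate the similitudes in two open sets, which gives the
    other one (proper_of_component).  An Omega is available for L as soon as
    PSim^+ has a point over L; one for L(t) is then an ultrapower of Omega
    (closed_extension_ratfun). *)

(** * Similitudes and reflections *)

Definition bform (R : comNzRingType) n (B : 'M[R]_n) (u v : 'rV[R]_n) : R :=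
  (u *m B *m v^T) 0 0.

Definition sim (R : comNzRingType) n (B g : 'M[R]_n) (c : R) : Prop :=
  g *m B *m g^T = c *: B.

Section Bilinear.
Variables (R : comNzRingType) (n : nat).
Implicit Types (B g h : 'M[R]_n) (u v w : 'rV[R]_n).

Lemma bformDl B u v w : bform B (u + v) w = bform B u w + bform B v w.
Proof. by rewrite /bform !mulmxDl mxE. Qed.

Lemma bformDr B u v w : bform B u (v + w) = bform B u v + bform B u w.
Proof. by rewrite /bform linearD /= mulmxDr mxE. Qed.

Lemma bformZl B a u v : bform B (a *: u) v = a * bform B u v.
Proof. by rewrite /bform -!scalemxAl mxE. Qed.

Lemma bformZr B a u v : bform B u (a *: v) = a * bform B u v.
Proof. by rewrite /bform linearZ /= -scalemxAr mxE. Qed.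

Lemma bformNl B u v : bform B (- u) v = - bform B u v.
Proof. by rewrite -scaleN1r bformZl mulN1r. Qed.

Lemma bformNr B u v : bform B u (- v) = - bform B u v.
Proof. by rewrite -scaleN1r bformZr mulN1r. Qed.

Lemma bform_suml B I (r : seq I) (P : pred I) (f : I -> 'rV[R]_n) w :
  bform B (\sum_(i <- r | P i) f i) w = \sum_(i <- r | P i) bform B (f i) w.
Proof.
elim/big_rec2: _ => [|i y x _ IH]; first by rewrite /bform !mul0mx mxE.
by rewrite bformDl IH.
Qed.

Lemma bform_sumr B I (r : seq I) (P : pred I) (f : I -> 'rV[R]_n) w :
  bform B w (\sum_(i <- r | P i) f i) = \sum_(i <- r | P i) bform B w (f i).
Proof.
elim/big_rec2: _ => [|i y x _ IH]; first by rewrite /bform trmx0 mulmx0 mxE.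
by rewrite bformDr IH.
Qed.

Lemma bformC B u v : B^T = B -> bform B u v = bform B v u.
Proof.
move=> Bs; rewrite /bform -[in RHS]Bs; transitivity ((u *m B *m v^T)^T 0 0).
  by rewrite [RHS]mxE.
by rewrite !trmx_mul trmxK mulmxA.
Qed.

Lemma bform_delta B i j : bform B (delta_mx 0 i) (delta_mx 0 j) = B i j.
Proof. by rewrite /bform -rowE trmx_delta -colE !mxE. Qed.

Lemma bform_row k l B (g : 'M_(k, n)) (h : 'M_(l, n)) i j :
  bform B (row i g) (row j h) = (g *m B *m h^T) i j.
Proof.
by rewrite /bform tr_row -!row_mul colE mulmxA -colE !mxE.
Qed.

Lemma simP B g c :
  (forall u v, bform B (u *m g) (v *m g) = c * bform B u v) <-> sim B g c.
Proof.
split=> [H|H u v]; last first.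
  by rewrite /bform trmx_mul -!mulmxA (mulmxA g) (mulmxA (g *m B)) H;
     rewrite -scalemxAl -scalemxAr mxE mulmxA.
apply/matrixP => i j; rewrite -bform_row mxE -bform_delta -H !rowE.
by rewrite /bform.
Qed.

Lemma sim_comp B g h c d : sim B g c -> sim B h d -> sim B (g *m h) (c * d).
Proof.
move=> Hg Hh; rewrite /sim trmx_mul -!mulmxA (mulmxA h) (mulmxA (h *m B)) Hh.
by rewrite -scalemxAl -scalemxAr mulmxA Hg scalerA mulrC.
Qed.

Lemma sim1 B : sim B 1%:M 1.
Proof. by rewrite /sim trmx1 mulmx1 mul1mx scale1r. Qed.

Lemma simZ B g c a : sim B g c -> sim B (a *: g) (a ^+ 2 * c).
Proof.
rewrite /sim => H; rewrite linearZ /= -!scalemxAl -scalemxAr H !scalerA.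
by rewrite expr2.
Qed.

Lemma sim_map (S : comNzRingType) (f : {rmorphism R -> S}) B g c :
  sim B g c -> sim (map_mx f B) (map_mx f g) (f c).
Proof. by rewrite /sim map_trmx -!map_mxM => ->; rewrite map_mxZ. Qed.

(** Both sides are the determinant of the block matrix with rows (1, v) and
    (u, 1), eliminated in two ways. *)
Lemma det_rank1 (u : 'cV[R]_n) (v : 'rV[R]_n) :
  \det (1%:M - u *m v) = 1 - (v *m u) 0 0.
Proof.
have e1 : block_mx 1%:M v u 1%:M =
    block_mx (1%:M : 'M_1) 0 u (1%:M : 'M_n) *m block_mx 1%:M v 0 (1%:M - u *m v).
  rewrite mulmx_block !(mul1mx, mulmx1, mul0mx, mulmx0, addr0, add0r).
  by rewrite addrC subrK.
have e2 : block_mx 1%:M v u 1%:M =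
    block_mx (1%:M - v *m u : 'M_1) v 0 (1%:M : 'M_n) *m block_mx 1%:M 0 u 1%:M.
  rewrite mulmx_block !(mul1mx, mulmx1, mul0mx, mulmx0, addr0, add0r).
  by rewrite subrK.
have := congr1 determinant e1; rewrite {1}e2 !det_mulmx !det_lblock !det_ublock.
rewrite !det1 !mul1r !mulr1 det_mx11 => <-.
by rewrite !mxE.
Qed.

End Bilinear.

Section Reflections.
Variables (F : fieldType) (n : nat) (B : 'M[F]_n).
Hypotheses (two : (2 : F) != 0) (Bsym : B^T = B).
Implicit Types (g h : 'M[F]_n) (u v w x y z : 'rV[F]_n).

Local Notation b := (bform B).
Local Notation q := (qvalue B).

Lemma qvalueE u : q u = b u u. Proof. by []. Qed.

Definition refl y : 'M[F]_n := 1%:M - ((2 / q y) *: (B *m y^T)) *m y.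

Lemma refl_act y v : v *m refl y = v - (2 * b v y / q y) *: y.
Proof.
rewrite /refl mulmxBr mulmx1 -scalemxAl -scalemxAr !mulmxA; congr (_ - _).
rewrite [_ *m B *m _]mx11_scalar mul_scalar_mx scalerA -/(b v y).
by congr (_ *: _); ring.
Qed.

Lemma refl_sim y : q y != 0 -> sim B (refl y) 1.
Proof.
move=> y0; apply/simP => u v; rewrite !refl_act !(bformDl, bformDr, bformNl, bformNr).
rewrite !(bformZl, bformZr) -qvalueE (bformC y v) //.
by field.
Qed.

Lemma det_refl y : q y != 0 -> \det (refl y) = -1.
Proof.
move=> y0; rewrite /refl det_rank1 -scalemxAr mxE mulmxA -/(b y y) -qvalueE.
by field.
Qed.

Lemma reflK y : q y != 0 -> refl y *m refl y = 1%:M.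
Proof.
move=> y0; apply/row_matrixP => i; rewrite row_mul -[row i 1%:M]mul1mx.
rewrite !rowE mul1mx mulmx1 !refl_act; set d := delta_mx 0 i.
rewrite !(bformDl, bformNl, bformZl) -qvalueE -addrA -opprD -scalerDl.
have -> : 2 * b d y / q y + 2 * (b d y - 2 * b d y / q y * q y) / q y = 0 by field.
by rewrite scale0r subr0.
Qed.

Lemma refl_fix y z : b z y = 0 -> z *m refl y = z.
Proof. by move=> zy; rewrite refl_act zy mulr0 mul0r scale0r subr0. Qed.

Definition prodrefl (us : seq 'rV[F]_n) : 'M[F]_n :=
  foldr (fun u r => refl u *m r) 1%:M us.

Lemma prodrefl_cat us vs : prodrefl (us ++ vs) = prodrefl us *m prodrefl vs.
Proof. by elim: us => [|u us IH] /=; rewrite ?mul1mx // IH mulmxA. Qed.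

Definition anisotropic_seq (us : seq 'rV[F]_n) := all (fun u => q u != 0) us.

Lemma prodrefl_sim us : anisotropic_seq us -> sim B (prodrefl us) 1.
Proof.
elim: us => [|u us IH] /=; first by move=> _; apply: sim1.
by move=> /andP[u0 /IH H]; rewrite -[1]mulr1; apply: sim_comp => //; apply: refl_sim.
Qed.

Lemma det_prodrefl us : anisotropic_seq us -> \det (prodrefl us) = (-1) ^+ size us.
Proof.
elim: us => [|u us IH] /=; first by rewrite det1.
by move=> /andP[u0 /IH H]; rewrite det_mulmx H det_refl // exprS.
Qed.

Lemma prodrefl_rev us : anisotropic_seq us ->
  prodrefl us *m prodrefl (rev us) = 1%:M.
Proof.
elim: us => [|u us IH] /=; first by rewrite mulmx1.
move=> /andP[u0 /IH H]; rewrite rev_cons -cats1 prodrefl_cat /= mulmx1.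
by rewrite mulmxA -(mulmxA (refl u)) H mulmx1 reflK.
Qed.

(** As q(x - y) + q(x + y) = 4 q(x), one of x - y and x + y is anisotropic:
    reflect in x - y, or else in x + y, which sends x to - y, and then in y. *)
Lemma move_vector x y : q x = q y -> q x != 0 ->
  exists us, [/\ anisotropic_seq us, x *m prodrefl us = y &
    forall z, b z x = 0 -> b z y = 0 -> z *m prodrefl us = z].
Proof.
move=> xy x0; have [xmy|xmy] := eqVneq (q (x - y)) 0; last first.
  exists [:: x - y]; split; rewrite /= ?xmy ?mulmx1 //.
    have e : q (x - y) = 2 * b x (x - y).
      rewrite qvalueE !(bformDl, bformDr, bformNl, bformNr) -!qvalueE -xy (bformC y x) //.
      by ring.
    by rewrite refl_act -e divff // scale1r opprB addrC subrK.
  move=> z zx zy; apply: refl_fix.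
  by rewrite bformDr bformNr zx zy subrr.
have xpy : q (x + y) != 0.
  have : q (x - y) + q (x + y) = 2 * 2 * q x.
    rewrite !qvalueE !(bformDl, bformDr, bformNl, bformNr) -!qvalueE -xy; ring.
  by rewrite xmy add0r => ->; rewrite !mulf_neq0.
exists [:: x + y; y]; split; rewrite /= ?xpy -?xy ?x0 ?mulmx1 //.
  have e : q (x + y) = 2 * b x (x + y).
    rewrite qvalueE !(bformDl, bformDr) -!qvalueE -xy (bformC y x) //; ring.
  rewrite mulmxA (refl_act (x + y)) -e divff // scale1r opprD addrA subrr add0r.
  rewrite mulNmx refl_act -qvalueE mulfK -?xy // scalerDl scale1r opprB.
  by rewrite addrK.
move=> z zx zy; have zxy : z *m refl (x + y) = z.
  by apply: refl_fix; rewrite bformDr zx zy addr0.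
by rewrite mulmxA zxy refl_fix.
Qed.

Hypothesis Bunit : B \in unitmx.

Lemma anisotropic_vector (A : 'M[F]_n) : A^T = A -> A != 0 ->
  exists v, qvalue A v != 0.
Proof.
move=> As /matrix0Pn[i [j Aij]].
pose d k : 'rV[F]_n := delta_mx 0 k.
have [Ai|Ai] := eqVneq (A i i) 0; last first.
  by exists (d i); rewrite /qvalue -/(bform A _ _) bform_delta.
have [Aj|Aj] := eqVneq (A j j) 0; last first.
  by exists (d j); rewrite /qvalue -/(bform A _ _) bform_delta.
exists (d i + d j); rewrite /qvalue -/(bform A _ _) bformDl !bformDr.
rewrite (bformC (d j) (d i)) // !bform_delta Ai Aj add0r addr0.
by rewrite -mulr2n -mulr_natl mulf_neq0.
Qed.

(** An orthogonal family that is not a basis extends: the projection p onto the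
    orthogonal complement of its span is not zero, so the form p B, which is B
    restricted to this complement, has an anisotropic vector. *)
Lemma orthogonal_family k : (k <= n)%N ->
  exists X : 'M[F]_(k, n), exists d : 'rV[F]_k,
    X *m B *m X^T = diag_mx d /\ forall i, d 0 i != 0.
Proof.
elim: k => [|k IH] kn.
  exists 0, 0; split=> [|[]//]; by apply/matrixP => -[].
have [X [d [Xd d0]]] := IH (ltnW kn).
pose e : 'rV[F]_k := \row_i (d 0 i)^-1.
have de : diag_mx d *m diag_mx e = 1%:M.
  rewrite mulmx_diag -diag_const_mx; congr diag_mx; apply/rowP => i.
  by rewrite !mxE divff.
(* the projection onto the orthogonal complement of the rows of X *)
pose p : 'M[F]_n := 1%:M - B *m X^T *m diag_mx e *m X.
have pX : p *m B *m X^T = 0.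
  have -> : p *m B *m X^T = B *m X^T - B *m X^T *m diag_mx e *m (X *m B *m X^T).
    by rewrite /p !mulmxBl mul1mx !mulmxA.
  by rewrite Xd -mulmxA diag_mxC de mulmx1 subrr.
have pBp : p *m B *m p^T = p *m B.
  rewrite [p^T]linearB /= trmx1 mulmxBr mulmx1 !trmx_mul trmxK Bsym tr_diag_mx.
  by rewrite !mulmxA pX !mul0mx subr0.
have pB0 : p *m B != 0.
  apply/eqP => pB; have p0 : p = 0 by rewrite -[p](mulmxK Bunit) pB mul0mx.
  have : (\rank (1%:M : 'M[F]_n) <= k)%N.
    move/eqP: p0; rewrite subr_eq0 => /eqP ->.
    exact: leq_trans (mxrankM_maxr _ _) (rank_leq_row _).
  by rewrite mxrank1 leqNgt kn.
have [|v v0] := @anisotropic_vector (p *m B) _ pB0.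
  by rewrite -pBp !trmx_mul trmxK Bsym mulmxA.
pose w := v *m p.
have wX : w *m B *m X^T = 0 by rewrite /w -!mulmxA (mulmxA p) pX mulmx0.
have w0 : q w != 0.
  rewrite /qvalue /w trmx_mul -!mulmxA (mulmxA p) (mulmxA (p *m B)) pBp.
  by rewrite mulmxA.
clearbody w; exists (col_mx w X), (row_mx (q w)%:M d); split.
  suff : (col_mx w X *m B *m (col_mx w X)^T =
          diag_mx (row_mx (q w)%:M d) :> 'M_(1 + k)) by [].
  rewrite tr_col_mx mul_col_mx mul_col_row wX Xd diag_mx_row.
  have -> : X *m B *m w^T = 0.
    by apply: trmx_inj; rewrite !trmx_mul trmxK Bsym mulmxA wX trmx0.
  congr (block_mx _ _ _ _); apply/matrixP => i j; rewrite !ord1 [RHS]mxE.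
  by rewrite [X in X *+ _]mxE !mulr1n.
by move=> i; rewrite mxE; case: (@fintype.split 1 k i) => j; rewrite ?ord1 ?mxE ?eqxx ?mulr1n.
Qed.

Lemma diagonalization : exists D : 'M[F]_n, exists d : 'rV[F]_n,
  [/\ D *m B *m D^T = diag_mx d, D \in unitmx & forall i, d 0 i != 0].
Proof.
have [D [d [Dd d0]]] := orthogonal_family (leqnn n).
exists D, d; split=> //.
have : diag_mx d \in unitmx.
  by rewrite unitmxE det_diag unitfE; apply/prodf_neq0 => i _.
by rewrite -Dd !unitmx_mul => /andP[/andP[]].
Qed.

(** Move the vectors of an orthogonal basis back into place, one after the other;
    the reflections used for one of them fix those already treated. *)
Lemma cartan_dieudonne g : sim B g 1 ->
  exists2 us, anisotropic_seq us & g = prodrefl us.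
Proof.
move=> gB; have [D [d [Dd Du d0]]] := diagonalization.
have bD i j : b (row i D) (row j D) = d 0 i *+ (i == j).
  by rewrite bform_row Dd mxE.
suff H k : (k <= n)%N -> exists us, anisotropic_seq us /\
    forall i : 'I_n, (i < k)%N -> row i D *m (g *m prodrefl us) = row i D.
  have [us [us0 Hus]] := H n (leqnn n).
  have gr : g *m prodrefl us = 1%:M.
    apply: (can_inj (mulKmx Du)); rewrite mulmx1; apply/row_matrixP => i.
    by rewrite row_mul Hus.
  have us0' : anisotropic_seq (rev us) by rewrite /anisotropic_seq all_rev.
  exists (rev us) => //.
  by rewrite -[g]mulmx1 -(prodrefl_rev us0) mulmxA gr mul1mx.
elim: k => [|k IH] kn; first by exists [::].
have [us [us0 Hus]] := IH (ltnW kn).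
pose h := g *m prodrefl us; pose i := Ordinal kn.
have hB : sim B h 1 by rewrite -[1]mulr1; apply: sim_comp => //; apply: prodrefl_sim.
have hb u v : b (u *m h) (v *m h) = b u v by rewrite (simP B h 1).2 // mul1r.
have [||vs [vs0 xy Hvs]] := @move_vector (row i D *m h) (row i D).
- exact: hb.
- by rewrite qvalueE hb bD eqxx mulr1n d0.
exists (us ++ vs); split; first by rewrite /anisotropic_seq all_cat; apply/andP.
move=> j; rewrite ltnS leq_eqVlt prodrefl_cat (mulmxA g) mulmxA => /orP[/eqP ji|jk].
  by have -> : j = i by apply: val_inj.
rewrite Hus // Hvs //; last by rewrite bD -val_eqE /= ltn_eqF.
by rewrite -{1}(Hus j) // hb bD -val_eqE /= ltn_eqF.
Qed.

End Reflections.

(** * Odd sums of units in a ring of Witt type *)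

Section OddSums.
Variables (R : comPzRingType) (U : R -> Prop).
Hypothesis U_sqr : forall a, U a -> a * a = 1.
Hypothesis U_opp : forall a, U a -> U (- a).

Definition pfister (us : seq R) : R := \prod_(u <- us) (1 + u).

Definition all_in (us : seq R) := forall u, u \in us -> U u.

Hypothesis pfister_torsion : forall us m, all_in us -> (0 < m)%N ->
  m%:R * pfister us = 0 -> exists k, 2 ^+ k * pfister us = 0.

Lemma all_in_cons a us : U a -> all_in us -> all_in (a :: us).
Proof. by move=> Ua H u; rewrite inE => /orP[/eqP ->|/H]. Qed.

Lemma all_in_cons_inv a us : all_in (a :: us) -> U a /\ all_in us.
Proof.
by move=> H; split=> [|u us_u]; apply: H; rewrite inE ?eqxx ?us_u ?orbT.
Qed.

Lemma pfister_cons a us : pfister (a :: us) = (1 + a) * pfister us.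
Proof. by rewrite /pfister big_cons. Qed.

(** The factors 1 + a and 1 - a add up to 2. *)
Lemma split_sign (a x p : R) k l : 2 ^+ k * ((1 + a) * p) * x = 0 ->
  2 ^+ l * ((1 - a) * p) * x = 0 -> 2 ^+ (k + l).+1 * p * x = 0.
Proof.
move=> H1 H2.
transitivity (2 ^+ l * (2 ^+ k * ((1 + a) * p) * x) +
              2 ^+ k * (2 ^+ l * ((1 - a) * p) * x)).
  by rewrite exprS exprD; ring.
by rewrite H1 H2 !mulr0 addr0.
Qed.

(** The integers q and r collect the units that have already become signs by
    multiplication with the Pfister factors in us; r + size la stays odd, so r is
    not zero when no unit is left. *)
Lemma odd_sum_torsion la lb us (r q z : int) :
  all_in la -> all_in lb -> all_in us -> r + (size la)%:Z = 2 * z + 1 ->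
  pfister us * (q%:~R + \sum_(b <- lb) b) * (r%:~R + \sum_(a <- la) a) = 0 ->
  exists k, 2 ^+ k * pfister us * (q%:~R + \sum_(b <- lb) b) = 0.
Proof.
elim: la r z us => [|a la IH] r z us.
  move=> _ + + rz; rewrite big_nil addr0.
  elim: lb q us => [|b lb IH] q us.
    move=> _ Hus; rewrite big_nil addr0 => H.
    have [->|q0] := eqVneq q 0; first by exists 0%N; rewrite mulr0.
    have r0 : r != 0.
      by apply/eqP => r0; move: rz; rewrite r0 /=; lia.
    have := @pfister_torsion us (absz (q * r)%R) Hus.
    rewrite absz_gt0 mulf_neq0 // => /(_ isT) Ht.
    suff /Ht[k Hk] : (absz (q * r)%R)%:R * pfister us = 0.
      by exists k; rewrite Hk mul0r.
    have sg (n : int) : exists2 s : R, s * s = 1 & (absz n)%:R = s * n%:~R.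
      case: n => n; first by exists 1; rewrite ?mul1r.
      by exists (-1); rewrite ?mulrNN ?mul1r // NegzE mulrNz mulrNN mul1r absz_nat.
    have [s _ ->] := sg (q * r); rewrite intrM.
    by transitivity (s * (pfister us * q%:~R * r%:~R)); [ring | rewrite H mulr0].
  move=> /all_in_cons_inv[Ub Hlb] Hus; rewrite big_cons => H.
  have [||k Hk] := IH (q + 1) (b :: us) Hlb; first exact: all_in_cons.
    rewrite pfister_cons rmorphD /=.
    transitivity ((1 + b) * (pfister us * (q%:~R + (b + \sum_(j <- lb) j)) * r%:~R)
                  + (1 - b * b) * pfister us * r%:~R).
      by ring.
    by rewrite H (U_sqr Ub) subrr mulr0 !mul0r addr0.
  have [||l Hl] := IH (q - 1) (- b :: us) Hlb.
  - by apply: all_in_cons => //; apply: U_opp.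
  - rewrite pfister_cons rmorphB /=.
    transitivity ((1 - b) * (pfister us * (q%:~R + (b + \sum_(j <- lb) j)) * r%:~R)
                  - (1 - b * b) * pfister us * r%:~R).
      by ring.
    by rewrite H (U_sqr Ub) subrr mulr0 !mul0r subr0.
  exists (k + l).+1; apply: (@split_sign b).
    rewrite -[RHS]Hk pfister_cons rmorphD /=.
    transitivity (2 ^+ k * ((1 + b) * pfister us) * (q%:~R + 1 + \sum_(j <- lb) j)
                  - 2 ^+ k * pfister us * (1 - b * b)); first by ring.
    by rewrite (U_sqr Ub) subrr mulr0 subr0.
  rewrite -[RHS]Hl pfister_cons rmorphB /=.
  transitivity (2 ^+ l * ((1 - b) * pfister us) * (q%:~R - 1 + \sum_(j <- lb) j)
                + 2 ^+ l * pfister us * (1 - b * b)); first by ring.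
  by rewrite (U_sqr Ub) subrr mulr0 addr0.
move=> /all_in_cons_inv[Ua Hla] Hlb Hus rz; rewrite big_cons => H.
have [|||k Hk] := IH (r + 1) z (a :: us) Hla Hlb; first exact: all_in_cons.
- by rewrite /= in rz; lia.
- rewrite pfister_cons rmorphD /=.
  set x := _ + _ in H *.
  transitivity ((1 + a) * (pfister us * x * (r%:~R + (a + \sum_(j <- la) j)))
                + (1 - a * a) * pfister us * x).
    by ring.
  by rewrite H (U_sqr Ua) subrr mulr0 !mul0r addr0.
have [|||l Hl] := IH (r - 1) (z - 1) (- a :: us) Hla Hlb.
- by apply: all_in_cons => //; apply: U_opp.
- by rewrite /= in rz; lia.
- rewrite pfister_cons rmorphB /=.
  set x := (q%:~R + _) in H *.
  transitivity ((1 - a) * (pfister us * x * (r%:~R + (a + \sum_(j <- la) j)))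
                - (1 - a * a) * pfister us * x).
    by ring.
  by rewrite H (U_sqr Ua) subrr mulr0 !mul0r subr0.
exists (k + l).+1; apply: (@split_sign a).
  by rewrite -pfister_cons.
by rewrite -pfister_cons.
Qed.

Lemma sum_sqr la : all_in la ->
  exists z, (\sum_(a <- la) a) * (\sum_(a <- la) a) = (size la)%:R + 2 * z.
Proof.
elim: la => [|a la IH]; first by exists 0; rewrite big_nil mul0r mulr0 addr0.
move=> /all_in_cons_inv[Ua /IH[z Hz]]; exists (z + a * \sum_(j <- la) j).
rewrite big_cons /= -[(size la).+1]addn1 natrD; set S := \sum_(j <- la) j in Hz *.
transitivity (a * a + S * S + 2 * (a * S)); first by ring.
by rewrite Hz (U_sqr Ua); ring.
Qed.

(** The square of an odd sum of units is 1 modulo 2, so such a sum acts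
    injectively on the elements killed by a power of 2; by odd_sum_torsion, any
    element that it kills is one of these. *)
Lemma odd_sum_regular la lb : all_in la -> all_in lb -> odd (size la) ->
  (\sum_(b <- lb) b) * (\sum_(a <- la) a) = 0 -> \sum_(b <- lb) b = 0.
Proof.
move=> Hla Hlb odd_la H; set x := \sum_(b <- lb) b in H *.
set y := \sum_(a <- la) a in H.
have [z Hz] := sum_sqr Hla.
have [z' yy] : exists z', y * y = 1 + 2 * z'.
  exists (z + (size la)./2%:R); rewrite Hz -[in (size la)%:R](odd_double_half (size la)).
  by rewrite odd_la add1n mulrS -muln2 natrM; ring.
have two_torsion x' : 2 * x' = 0 -> x' * y = 0 -> x' = 0.
  move=> x2 xy; transitivity (x' * (y * y) - z' * (2 * x')); first by rewrite yy; ring.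
  by rewrite mulrA xy x2 mul0r mulr0 subr0.
have [|||k] := @odd_sum_torsion la lb [::] 0 0 (size la)./2%:Z Hla Hlb.
- by [].
- by lia.
- by rewrite /pfister big_nil !add0r mul1r.
rewrite /pfister big_nil add0r mulr1 -/x.
elim: k => [|k IH]; first by rewrite mul1r.
move=> Hk; apply: IH; apply: two_torsion; first by rewrite mulrA -exprS.
by rewrite -mulrA H mulr0.
Qed.

End OddSums.

(** * Congruence of matrices *)

(** Allowing two sizes, which are equal a posteriori, avoids casts. *)
Definition congruent (F : fieldType) n m (A : 'M[F]_n) (B : 'M[F]_m) : Prop :=
  exists P : 'M[F]_(n, m), exists Q : 'M[F]_(m, n),
    [/\ P *m Q = 1%:M, Q *m P = 1%:M & P *m B *m P^T = A].

Section Congruence.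
Variable F : fieldType.

Lemma congruent_refl n (A : 'M[F]_n) : congruent A A.
Proof. by exists 1%:M, 1%:M; rewrite trmx1 !mulmx1 mul1mx. Qed.

Lemma congruent_sym n m (A : 'M[F]_n) (B : 'M[F]_m) :
  congruent A B -> congruent B A.
Proof.
move=> [P [Q [PQ QP <-]]]; exists Q, P; split=> //.
by rewrite !mulmxA QP mul1mx -mulmxA -trmx_mul QP trmx1 mulmx1.
Qed.

Lemma congruent_trans n m p (A : 'M[F]_n) (B : 'M[F]_m) (C : 'M[F]_p) :
  congruent A B -> congruent B C -> congruent A C.
Proof.
move=> [P [Q [PQ QP <-]]] [P' [Q' [PQ' QP' <-]]]; exists (P *m P'), (Q' *m Q).
split; last by rewrite trmx_mul !mulmxA.
  by rewrite -mulmxA (mulmxA P') PQ' mul1mx.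
by rewrite -mulmxA (mulmxA Q) QP mul1mx.
Qed.

Lemma congruent_size n m (A : 'M[F]_n) (B : 'M[F]_m) : congruent A B -> n = m.
Proof.
move=> [P [Q [PQ QP _]]]; apply/eqP.
by rewrite eqn_leq (mulmx1_min PQ) (mulmx1_min QP).
Qed.

Lemma congruentZ n m c (A : 'M[F]_n) (B : 'M[F]_m) :
  congruent A B -> congruent (c *: A) (c *: B).
Proof.
move=> [P [Q [PQ QP <-]]]; exists P, Q; split=> //.
by rewrite -scalemxAr -scalemxAl.
Qed.

Lemma congruent_unit n (A B P : 'M[F]_n) :
  P *m B *m P^T = A -> A \in unitmx -> congruent A B.
Proof.
move=> PBP; rewrite -PBP !unitmx_mul => /andP[/andP[Pu _] _].
by exists P, (invmx P); rewrite mulmxV ?mulVmx.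
Qed.

Lemma congruent_block n m n' m' (A : 'M[F]_n) (A' : 'M[F]_n') (B : 'M[F]_m)
    (B' : 'M[F]_m') : congruent A A' -> congruent B B' ->
  congruent (block_mx A 0 0 B) (block_mx A' 0 0 B').
Proof.
move=> [P [Q [PQ QP <-]]] [P' [Q' [PQ' QP' <-]]].
exists (block_mx P 0 0 P'), (block_mx Q 0 0 Q').
rewrite !tr_block_mx !trmx0 !mulmx_block !(mulmx0, mul0mx, addr0, add0r).
by rewrite PQ QP PQ' QP' -!scalar_mx_block.
Qed.

Lemma tensmx1 n m : tensmx (1%:M : 'M[F]_n) (1%:M : 'M[F]_m) = 1%:M.
Proof.
apply/matrixP => i j; case: (mxtens_indexP i) => i1 i2.
case: (mxtens_indexP j) => j1 j2; rewrite tensmxE !mxE -natrM mulnb.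
by rewrite (can_eq (@mxtens_indexK _ _)) xpair_eqE.
Qed.

Lemma unitmx_tens n m (A : 'M[F]_n) (B : 'M[F]_m) :
  A \in unitmx -> B \in unitmx -> tensmx A B \in unitmx.
Proof.
move=> Au Bu; have : tensmx (invmx A) (invmx B) *m tensmx A B = 1%:M.
  by rewrite tensmx_mul !mulVmx // tensmx1.
by case/mulmx1_unit.
Qed.

Lemma congruent_tens n m n' m' (A : 'M[F]_n) (A' : 'M[F]_n') (B : 'M[F]_m)
    (B' : 'M[F]_m') : congruent A A' -> congruent B B' ->
  congruent (tensmx A B) (tensmx A' B').
Proof.
move=> [P [Q [PQ QP <-]]] [P' [Q' [PQ' QP' <-]]].
exists (tensmx P P'), (tensmx Q Q').
by rewrite trmx_tens !tensmx_mul PQ QP PQ' QP' !tensmx1.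
Qed.

Lemma congruent_diag n m (d : 'rV[F]_n) (e : 'rV[F]_m) : n = m ->
  (forall i j, nat_of_ord i = nat_of_ord j -> d 0 i = e 0 j) ->
  congruent (diag_mx d) (diag_mx e).
Proof.
move=> nm; move: e; rewrite -nm => e de.
have -> : d = e by apply/rowP => i; apply: de.
exact: congruent_refl.
Qed.

End Congruence.

(** * Diagonal forms *)

(** Diagonal forms are lists of these: the forms of the Witt ring have to be
    nondegenerate. *)
Record nzscalar (F : fieldType) := NzScalar { nzval :> F; _ : nzval != 0 }.
HB.instance Definition _ F := [isSub for @nzval F].
HB.instance Definition _ (F : fieldType) := [Choice of nzscalar F by <:].

Section DiagonalForms.
Variable F : fieldType.
Hypothesis two : (2 : F) != 0.
Implicit Types (a b c d : nzscalar F) (s t u : seq (nzscalar F)).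

Lemma nzval_neq0 a : (a : F) != 0. Proof. by case: a. Qed.

Definition nz1 : nzscalar F := NzScalar (oner_neq0 F).
Lemma nzopp_proof a : - (a : F) != 0. Proof. by rewrite oppr_eq0 nzval_neq0. Qed.
Definition nzopp a := NzScalar (nzopp_proof a).
Lemma nzmul_proof a b : (a : F) * (b : F) != 0.
Proof. by rewrite mulf_neq0 ?nzval_neq0. Qed.
Definition nzmul a b := NzScalar (nzmul_proof a b).

Lemma nzmulA : associative nzmul.
Proof. by move=> a b c; apply: val_inj; rewrite /= mulrA. Qed.
Lemma nzmulC : commutative nzmul.
Proof. by move=> a b; apply: val_inj; rewrite /= mulrC. Qed.
Lemma nzmul1 : left_id nz1 nzmul.
Proof. by move=> a; apply: val_inj; rewrite /= mul1r. Qed.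

Fixpoint diag_form s : 'M[F]_(size s) :=
  if s is a :: s' return 'M_(size s)
  then block_mx ((a : F)%:M : 'M_1) 0 0 (diag_form s') else 0.

Lemma diag_formE s : diag_form s = diag_mx (\row_i (nth nz1 s i : F)).
Proof.
elim: s => [|a s IH]; first by apply/matrixP => -[].
apply/matrixP => i j.
rewrite [RHS]mxE mxE.
case: (@split_ordP 1 (size s) i) => i' ->; rewrite mxE;
  case: (@split_ordP 1 (size s) j) => j' ->.
- by rewrite !ord1 !mxE.
- by rewrite !mxE /= -val_eqE /= ord1.
- by rewrite !mxE /= -val_eqE /= ord1.
by rewrite -/(diag_form s) IH !mxE -!val_eqE.
Qed.

Lemma diag_form_sym s : (diag_form s)^T = diag_form s.
Proof. by rewrite diag_formE tr_diag_mx. Qed.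

Lemma diag_form_unit s : diag_form s \in unitmx.
Proof.
rewrite diag_formE unitmxE det_diag unitfE; apply/prodf_neq0 => i _.
by rewrite mxE nzval_neq0.
Qed.

Definition iso s t := congruent (diag_form s) (diag_form t).

Lemma iso_refl s : iso s s. Proof. exact: congruent_refl. Qed.
Lemma iso_sym s t : iso s t -> iso t s. Proof. exact: congruent_sym. Qed.
Lemma iso_trans t s u : iso s t -> iso t u -> iso s u.
Proof. exact: congruent_trans. Qed.
Lemma iso_size s t : iso s t -> size s = size t. Proof. exact: congruent_size. Qed.

Lemma iso_cons a s t : iso s t -> iso (a :: s) (a :: t).
Proof. exact: (@congruent_block F 1 _ 1 _ _ _ _ _ (congruent_refl _)). Qed.

Lemma congruent_cat s t :
  congruent (diag_form (s ++ t)) (block_mx (diag_form s) 0 0 (diag_form t)).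
Proof.
rewrite !diag_formE -diag_mx_row; apply: congruent_diag; first exact: size_cat.
move=> i j ij; rewrite !mxE nth_cat ij.
by case: split_ordP => k ->; rewrite [RHS]mxE //= addKn.
Qed.

Lemma iso_cat s s' t t' : iso s s' -> iso t t' -> iso (s ++ t) (s' ++ t').
Proof.
move=> ss tt; apply: congruent_trans (congruent_cat s t) _.
apply: congruent_trans (congruent_block ss tt) _.
exact: congruent_sym (congruent_cat s' t').
Qed.

Lemma congruent_scale c s :
  congruent (diag_form (map (nzmul c) s)) ((c : F) *: diag_form s).
Proof.
rewrite !diag_formE -linearZ /=; apply: congruent_diag; first exact: size_map.
move=> i j ij; rewrite !mxE (nth_map nz1) ?ij //.
Qed.

Lemma iso_map c s t : iso s t -> iso (map (nzmul c) s) (map (nzmul c) t).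
Proof.
move=> st; apply: congruent_trans (congruent_scale c s) _.
apply: congruent_trans (congruentZ (c : F) st) _.
exact: congruent_sym (congruent_scale c t).
Qed.

(** The hypotheses say that (x, y) and (z, w) are orthogonal vectors of the plane
    <c, d>, with values a and b; they are a basis because a and b are not zero. *)
Lemma iso_binary (a b c d : nzscalar F) (x y z w : F) :
    (a : F) = (c : F) * x ^+ 2 + (d : F) * y ^+ 2 ->
    (b : F) = (c : F) * z ^+ 2 + (d : F) * w ^+ 2 ->
    (c : F) * x * z + (d : F) * y * w = 0 ->
  iso [:: a; b] [:: c; d].
Proof.
move=> ax bz xz.
pose P : 'M[F]_2 := \matrix_(i, j) nth 0 (nth [::] [:: [:: x; y]; [:: z; w]] i) j.
apply: (@congruent_unit F 2 (diag_form [:: a; b]) (diag_form [:: c; d]) P _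
          (diag_form_unit [:: a; b])).
rewrite !diag_formE mul_mx_diag; apply/matrixP => i j.
rewrite !mxE !big_ord_recl big_ord0 !mxE /=.
case: i => [[|[|i]] //= ilt]; case: j => [[|[|j]] //= jlt].
- by rewrite ax; ring.
- by transitivity ((c : F) * x * z + (d : F) * y * w) => //; ring.
- by transitivity ((c : F) * x * z + (d : F) * y * w) => //; ring.
by rewrite bz; ring.
Qed.

Lemma iso_swap a b s : iso (a :: b :: s) (b :: a :: s).
Proof.
apply: (@iso_cat [:: a; b] [:: b; a] s s); last exact: iso_refl.
by apply: (@iso_binary _ _ _ _ 0 1 1 0); ring.
Qed.

Lemma iso_move a s t : iso (a :: s ++ t) (s ++ a :: t).
Proof.
elim: s => [|b s IH] /=; first exact: iso_refl.
exact: iso_trans (iso_swap a b (s ++ t)) (iso_cons b IH).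
Qed.

Lemma iso_perm s t : perm_eq s t -> iso s t.
Proof.
elim: s t => [|a s IH] t.
  by rewrite perm_sym => /perm_nilP ->; apply: iso_refl.
move=> st; have a_t : a \in t by rewrite -(perm_mem st) mem_head.
case/splitPr: a_t st => t1 t2 st.
apply: iso_trans (iso_move a t1 t2); apply: iso_cons; apply: IH.
by rewrite -(perm_cons a) (perm_trans st) // -cat1s perm_catCA.
Qed.

(** ** Witt cancellation *)

(** Follow the isometry by reflections that bring the image of the first basis
    vector back to the first basis vector; the result is block diagonal. *)
Lemma congruent_cancel n m (a : F) (A : 'M[F]_n) (B : 'M[F]_m) :
  a != 0 -> B^T = B ->
  congruent (block_mx (a%:M : 'M_1) 0 0 A) (block_mx (a%:M : 'M_1) 0 0 B) ->
  congruent A B.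
Proof.
move=> a0 Bs [P [Q [PQ QP PBP]]]; set B1 := block_mx _ 0 0 B in PBP.
have B1s : B1^T = B1 by rewrite tr_block_mx !trmx0 tr_scalar_mx Bs.
pose e0 : 'rV[F]_(1 + m) := row_mx 1%:M 0.
have qe0 : qvalue B1 e0 = a.
  rewrite /qvalue /e0 tr_row_mx trmx1 trmx0 mul_row_block !(mul1mx, mulmx0, mul0mx).
  by rewrite !addr0 mul_row_col mulmx1 mulmx0 addr0 mxE.
pose x : 'rV[F]_(1 + m) := usubmx P.
have xE : x = row (lshift n (0 : 'I_1)) P.
  by apply/rowP => i; rewrite !mxE; congr (P _ _); apply: val_inj.
have qx : qvalue B1 x = a.
  by rewrite /qvalue -/(bform B1 x x) xE bform_row PBP block_mxEul mxE.
have [||us [us0 xr _]] := @move_vector F _ B1 two B1s x e0; rewrite ?qx ?qe0 //.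
set r := prodrefl B1 us in xr; have rB1 : sim B1 r 1 by apply: prodrefl_sim.
have rr : r *m prodrefl B1 (rev us) = 1%:M by apply: prodrefl_rev.
have rr' : prodrefl B1 (rev us) *m r = 1%:M by apply: mulmx1C.
set r' := prodrefl B1 (rev us) in rr rr'.
pose P1 := P *m r; pose Q1 := r' *m Q.
have PQ1 : P1 *m Q1 = 1%:M by rewrite mulmxA -(mulmxA P) rr mulmx1.
have QP1 : Q1 *m P1 = 1%:M by rewrite mulmxA -(mulmxA r') QP mulmx1.
have PBP1 : P1 *m B1 *m P1^T = block_mx (a%:M : 'M_1) 0 0 A.
  by rewrite trmx_mul !mulmxA -(mulmxA P) -(mulmxA P) rB1 scale1r.
have P1u : usubmx P1 = row_mx 1%:M 0 by rewrite -mul_usub_mx.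
have [C [D P1E]] : exists C D, P1 = block_mx 1%:M 0 C D.
  exists (dlsubmx P1), (drsubmx P1); rewrite -[LHS]submxK; congr block_mx.
    by rewrite /ulsubmx P1u row_mxKl.
  by rewrite /ursubmx P1u row_mxKr.
have C0 : C = 0.
  move: PBP1; rewrite P1E tr_block_mx !mulmx_block trmx1 trmx0.
  rewrite !(mul1mx, mulmx1, mulmx0, mul0mx, addr0, add0r) => /eq_block_mx[_ _ + _].
  by rewrite mul_mx_scalar => /(canRL (scalerK a0)); rewrite scaler0.
exists D, (drsubmx Q1); move: PQ1 QP1 PBP1.
rewrite P1E C0 -[Q1]submxK tr_block_mx !mulmx_block trmx1 !trmx0.
rewrite !(mul1mx, mulmx1, mulmx0, mul0mx, addr0, add0r) block_mxKdr.
rewrite !scalar_mx_block => /eq_block_mx[_ _ _ ->] /eq_block_mx[_ _ _ ->].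
by move=> /eq_block_mx[_ _ _ ->].
Qed.

Lemma iso_cancel1 a s t : iso (a :: s) (a :: t) -> iso s t.
Proof. exact: congruent_cancel (nzval_neq0 a) (diag_form_sym t). Qed.

Lemma iso_cancel u s t : iso (s ++ u) (t ++ u) -> iso s t.
Proof.
elim: u => [|a u IH]; first by rewrite !cats0.
move=> H; apply: IH; apply: (@iso_cancel1 a).
apply: iso_trans (iso_move a s u) (iso_trans H _).
exact: iso_sym (iso_move a t u).
Qed.

(** ** Hyperbolic forms *)

Definition hyp k := flatten (nseq k [:: nz1; nzopp nz1]).

Lemma size_hyp k : size (hyp k) = k.*2.
Proof. by elim: k => //= k ->; rewrite doubleS. Qed.

Lemma hypD k l : hyp (k + l) = hyp k ++ hyp l.
Proof. by rewrite /hyp nseqD flatten_cat. Qed.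

(** The plane <1, -1> takes the value a = ((1 + a) / 2)^2 - ((1 - a) / 2)^2. *)
Lemma iso_plane a : iso [:: a; nzopp a] [:: nz1; nzopp nz1].
Proof.
apply: (@iso_binary _ _ _ _ ((1 + (a : F)) / 2) ((1 - (a : F)) / 2)
          ((1 - (a : F)) / 2) ((1 + (a : F)) / 2)) => /=; field => //.
Qed.

Lemma iso_opp s : iso (s ++ map nzopp s) (hyp (size s)).
Proof.
elim: s => [|a s IH]; first exact: iso_refl.
apply: (@iso_trans ([:: a; nzopp a] ++ (s ++ map nzopp s))).
  by apply: iso_perm; rewrite /= perm_cons -cat1s perm_catCA.
exact: iso_cat (iso_plane a) IH.
Qed.

(** * The Witt ring *)

(** Adding hyperbolic planes on both sides makes transitivity independent of Witt
    cancellation. *)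
Definition witt_equiv s t := exists k l, iso (s ++ hyp k) (t ++ hyp l).

Lemma iso_witt s t : iso s t -> witt_equiv s t.
Proof. by move=> st; exists 0%N, 0%N; rewrite !cats0. Qed.

Lemma witt_equiv_sym s t : witt_equiv s t -> witt_equiv t s.
Proof. by move=> [k [l H]]; exists l, k; apply: iso_sym. Qed.

Lemma witt_equiv_trans t s u : witt_equiv s t -> witt_equiv t u -> witt_equiv s u.
Proof.
move=> [k [l H]] [k' [l' H']]; exists (k + k')%N, (l' + l)%N.
rewrite !hypD !catA; apply: iso_trans (iso_cat H (iso_refl _)) _.
apply: (@iso_trans ((t ++ hyp k') ++ hyp l)).
  by apply: iso_perm; rewrite -!catA perm_cat2l perm_catC.
exact: iso_cat H' (iso_refl _).
Qed.

Lemma witt_equiv_cat s s' t t' :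
  witt_equiv s s' -> witt_equiv t t' -> witt_equiv (s ++ t) (s' ++ t').
Proof.
move=> [k [l H]] [k' [l' H']]; exists (k + k')%N, (l + l')%N.
rewrite !hypD.
have ac (a b c d : seq (nzscalar F)) : iso ((a ++ b) ++ c ++ d) ((a ++ c) ++ b ++ d).
  by apply: iso_perm; rewrite -!catA perm_cat2l perm_catCA.
apply: iso_trans (ac _ _ _ _) (iso_trans (iso_cat H H') _); exact: ac.
Qed.

Definition witt_rel s t := `[< witt_equiv s t >].

Lemma witt_rel_equiv : equiv_class_of witt_rel.
Proof.
split=> [s|s t|t s u].
- by apply/asboolP/iso_witt/iso_refl.
- by apply: asbool_equiv_eq; split=> /witt_equiv_sym.
- move=> /asboolP st /asboolP tu; apply/asboolP; exact: witt_equiv_trans st tu.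
Qed.

Canonical witt_eqrel := EquivRelPack witt_rel_equiv.

Definition form_mul s t := [seq nzmul a b | a <- s, b <- t].

Lemma form_mul_consr s b t :
  perm_eq (form_mul s (b :: t)) (map (nzmul b) s ++ form_mul s t).
Proof.
apply/permPl => u; rewrite /form_mul perm_allpairs_consr.
by rewrite (eq_map (fun a => nzmulC a b)).
Qed.

Lemma form_mulC s t : perm_eq (form_mul s t) (form_mul t s).
Proof.
elim: s t => [|a s IH] t; first by elim: t.
rewrite perm_sym (perm_trans (form_mul_consr _ _ _)) // perm_sym.
by rewrite /form_mul allpairs_cons perm_cat2l IH.
Qed.

Lemma form_mul_map a s t : form_mul (map (nzmul a) s) t = map (nzmul a) (form_mul s t).
Proof.
rewrite /form_mul allpairs_mapl map_allpairs.
by apply: eq_allpairs => b c; rewrite nzmulA.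
Qed.

Lemma form_mulA : associative form_mul.
Proof.
move=> s t u; elim: s => //= a s IH.
rewrite {1}/form_mul /= -/(form_mul _ _) IH [in RHS]/form_mul /=.
rewrite [in RHS]allpairs_cat -!/(form_mul _ _); congr (_ ++ _).
by rewrite form_mul_map.
Qed.

Lemma form_mulDl s t u : form_mul (s ++ t) u = form_mul s u ++ form_mul t u.
Proof. exact: allpairs_cat. Qed.

Lemma form_mul1 s : form_mul [:: nz1] s = s.
Proof. by rewrite /form_mul /= cats0 (eq_map nzmul1) map_id. Qed.

Lemma iso_hyp_map a k : iso (map (nzmul a) (hyp k)) (hyp k).
Proof.
elim: k => [|k IH]; first exact: iso_refl.
apply: (@iso_cat [:: nzmul a nz1; nzmul a (nzopp nz1)] _ _ _ _ IH).
have -> : nzmul a (nzopp nz1) = nzopp (nzmul a nz1).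
  by apply: val_inj; rewrite /= mulrN.
exact: iso_plane.
Qed.

Lemma witt_equiv_map a s t :
  witt_equiv s t -> witt_equiv (map (nzmul a) s) (map (nzmul a) t).
Proof.
move=> [k [l H]]; exists k, l.
apply: iso_trans (iso_cat (iso_refl _) (iso_sym (iso_hyp_map a k))) _.
apply: iso_trans (iso_cat (iso_refl _) (iso_hyp_map a l)).
by rewrite -!map_cat; apply: iso_map.
Qed.

(** Up to the order of the entries, the product with u is a sum of scalings by
    the entries of u. *)
Lemma witt_equiv_mul s t u :
  witt_equiv s t -> witt_equiv (form_mul s u) (form_mul t u).
Proof.
move=> st; elim: u => [|b u IH].
  by rewrite /form_mul !allpairs0r; apply/iso_witt/iso_refl.
apply: witt_equiv_trans (iso_witt (iso_perm (form_mul_consr _ _ _))) _.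
apply: witt_equiv_trans (witt_equiv_cat (witt_equiv_map b st) IH) _.
by apply/witt_equiv_sym/iso_witt/iso_perm/form_mul_consr.
Qed.

Lemma witt_equiv_opp s : witt_equiv (s ++ map nzopp s) [::].
Proof. by exists 0%N, (size s); rewrite cats0; apply: iso_opp. Qed.

End DiagonalForms.

Section WittRing.
Local Open Scope quotient_scope.
Variable F : fieldType.
Hypothesis two : (2 : F) != 0.
Implicit Types (a b c d : nzscalar F) (s t u : seq (nzscalar F)).

Definition witt_quotient := {eq_quot (@witt_eqrel F)}.
HB.instance Definition _ := Choice.on witt_quotient.
HB.instance Definition _ := EqQuotient.on witt_quotient.

Definition wcls s : witt_quotient := \pi_witt_quotient s.

Lemma wclsP s t : wcls s = wcls t <-> witt_equiv s t.
Proof.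
split=> [/eqP|st]; last by apply/eqP; rewrite /wcls eqmodE; apply/asboolP.
by rewrite /wcls eqmodE => /asboolP.
Qed.

Lemma wcls_repr (x : witt_quotient) : wcls (repr x) = x. Proof. exact: reprK. Qed.

Lemma wcls_perm s t : perm_eq s t -> wcls s = wcls t.
Proof. by move=> st; apply/wclsP/iso_witt/iso_perm. Qed.

Definition wadd (x y : witt_quotient) := wcls (repr x ++ repr y).
Definition wopp (x : witt_quotient) := wcls (map (@nzopp F) (repr x)).
Definition wmul (x y : witt_quotient) := wcls (form_mul (repr x) (repr y)).

Lemma repr_wcls s : witt_equiv (repr (wcls s)) s.
Proof. by apply/wclsP; rewrite wcls_repr. Qed.

Lemma wadd_cls s t : wadd (wcls s) (wcls t) = wcls (s ++ t).
Proof. by apply/wclsP/witt_equiv_cat; apply: repr_wcls. Qed.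

Lemma wmul_clsl s x : wmul (wcls s) x = wcls (form_mul s (repr x)).
Proof. by apply/wclsP/(witt_equiv_mul two)/repr_wcls. Qed.

Lemma wmulC : commutative wmul.
Proof. by move=> x y; apply/wcls_perm/form_mulC. Qed.

Lemma wmul_cls s t : wmul (wcls s) (wcls t) = wcls (form_mul s t).
Proof.
rewrite wmul_clsl (wcls_perm (form_mulC _ _)).
rewrite (wcls_perm (form_mulC s t)).
by apply/wclsP/(witt_equiv_mul two)/repr_wcls.
Qed.

Lemma waddA : associative wadd.
Proof.
by move=> x y z; rewrite -[x]wcls_repr -[y]wcls_repr -[z]wcls_repr !wadd_cls catA.
Qed.

Lemma waddC : commutative wadd.
Proof. by move=> x y; apply/wcls_perm; rewrite perm_catC. Qed.

Lemma wadd0 : left_id (wcls [::]) wadd.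
Proof. by move=> x; rewrite -[x]wcls_repr wadd_cls. Qed.

Lemma waddN : left_inverse (wcls [::]) wopp wadd.
Proof.
move=> x; rewrite waddC -[x in wadd x]wcls_repr wadd_cls.
by apply/wclsP; apply: witt_equiv_opp.
Qed.

Lemma wmulA : associative wmul.
Proof.
move=> x y z; rewrite -[x]wcls_repr -[y]wcls_repr -[z]wcls_repr !wmul_cls.
by rewrite form_mulA.
Qed.

Lemma wmul1 : left_id (wcls [:: nz1 F]) wmul.
Proof. by move=> x; rewrite -[x]wcls_repr wmul_cls form_mul1. Qed.

Lemma wmulDl : left_distributive wmul wadd.
Proof.
move=> x y z; rewrite -[x]wcls_repr -[y]wcls_repr -[z]wcls_repr.
by rewrite !(wmul_cls, wadd_cls) form_mulDl.
Qed.

(** The proof that 2 is invertible is an argument of the type, because in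
    characteristic 2 the class of - s would not be the opposite of that of s. *)
Definition witt_ring : Type := let _ := two in witt_quotient.
HB.instance Definition _ := Choice.on witt_ring.
HB.instance Definition _ := GRing.isZmodule.Build witt_ring waddA waddC wadd0 waddN.
HB.instance Definition _ := GRing.Zmodule_isComPzRing.Build witt_ring wmulA wmulC wmul1 wmulDl.

Definition witt_class s : witt_ring := wcls s.

Lemma witt_class_cat s t : witt_class (s ++ t) = witt_class s + witt_class t.
Proof. by rewrite /witt_class -wadd_cls. Qed.

Lemma witt_class_mul s t : witt_class (form_mul s t) = witt_class s * witt_class t.
Proof. by rewrite /witt_class -wmul_cls. Qed.

Lemma witt_class_1 : witt_class [:: nz1 F] = 1. Proof. by []. Qed.

End WittRing.

Section OddFactor.
Variable F : fieldType.
Hypothesis two : (2 : F) != 0.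
Implicit Types (a b c d : nzscalar F) (s t us : seq (nzscalar F)).

Local Notation nz1 := (nz1 F).

(** ** Values of diagonal forms *)

Fixpoint form_value s (x : seq F) : F :=
  match s, x with
  | a :: s', x0 :: x' => (a : F) * x0 ^+ 2 + form_value s' x'
  | _, _ => 0
  end.

Lemma form_value_sum s x : form_value s x = \sum_(i < size s) (nth nz1 s i : F) * x`_i ^+ 2.
Proof.
elim: s x => [|a s IH] [|x0 x] /=; rewrite ?big_ord0 //.
  by rewrite big1 // => i _; rewrite nth_nil expr0n mulr0.
by rewrite big_ord_recl IH.
Qed.

Lemma form_value_cat s t x y : size x = size s ->
  form_value (s ++ t) (x ++ y) = form_value s x + form_value t y.
Proof.
elim: s x => [|a s IH] [|x0 x] //=; first by rewrite add0r.
by move=> [/IH ->]; rewrite addrA.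
Qed.

Lemma form_value_map a s x : form_value (map (nzmul a) s) x = (a : F) * form_value s x.
Proof.
elim: s x => [|b s IH] [|x0 x] /=; rewrite ?mulr0 // IH.
by rewrite mulrDr mulrA.
Qed.

Lemma qvalue_diag_form s (v : 'rV[F]_(size s)) (x : seq F) :
  (forall i : 'I_(size s), x`_i = v 0 i) -> qvalue (diag_form s) v = form_value s x.
Proof.
move=> xv; rewrite /qvalue diag_formE mul_mx_diag mxE form_value_sum.
by apply: eq_bigr => i _; rewrite !mxE xv; ring.
Qed.

Definition isotropic s :=
  exists x, [/\ size x = size s, has (fun y => y != 0) x & form_value s x = 0].

Lemma isotropic_cat s t : isotropic s -> isotropic (s ++ t).
Proof.
move=> [x [sx x0 ex]]; exists (x ++ nseq (size t) 0).
rewrite !size_cat size_nseq sx has_cat x0 form_value_cat // ex add0r; split=> //.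
by rewrite form_value_sum big1 // => i _; rewrite nth_nseq if_same expr0n mulr0.
Qed.

Lemma isotropic_hyp k : isotropic (hyp F k.+1).
Proof.
apply: (@isotropic_cat [:: nz1; nzopp nz1]); exists [:: 1; 1].
by rewrite /= oner_eq0; split=> //; ring.
Qed.

Lemma isotropic_iso s t : iso s t -> isotropic t -> isotropic s.
Proof.
move=> [P [Q [PQ QP PtP]]] [x [sx x0 ex]].
pose v : 'rV[F]_(size t) := \row_i x`_i.
pose w := v *m Q.
exists [seq w 0 i | i <- enum 'I_(size s)].
have wE (i : 'I_(size s)) : [seq w 0 i | i <- enum 'I_(size s)]`_i = w 0 i.
  by rewrite (nth_map i) ?size_enum_ord // nth_ord_enum.
split; first by rewrite size_map size_enum_ord.
  apply: contraLR x0; rewrite -all_predC => /allP w0.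
  have : w = 0.
    apply/rowP => i; rewrite [RHS]mxE; apply/eqP.
    have /w0 : w 0 i \in [seq w 0 i | i <- enum 'I_(size s)].
      by rewrite (map_f (fun i => w 0 i)) // mem_enum.
    by rewrite /= negbK.
  move/(congr1 (mulmx^~ P)); rewrite mul0mx -mulmxA QP mulmx1 => v0.
  apply/hasPn => y /(nthP 0)[i ilt <-]; rewrite sx in ilt.
  by have /rowP/(_ (Ordinal ilt)) := v0; rewrite !mxE /= => ->; rewrite negbK.
rewrite -(qvalue_diag_form wE) -PtP /qvalue /w !mulmxA -(mulmxA v) QP mulmx1.
rewrite -!mulmxA -trmx_mul -mulmxA QP mulmx1 mulmxA.
by rewrite -/(qvalue _ _) (@qvalue_diag_form _ _ x) // => i; rewrite mxE.
Qed.

(** ** Relations in the Witt ring *)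

Local Notation W := (witt_ring two).
Local Notation witt_class := (@witt_class F two).
Definition unit_class a : W := witt_class [:: a].
Local Notation e := unit_class.

Lemma witt_class_eqP s t : witt_class s = witt_class t <-> witt_equiv s t.
Proof. exact: wclsP. Qed.

Lemma witt_class_iso s t : iso s t -> witt_class s = witt_class t.
Proof. by move=> st; apply/witt_class_eqP/iso_witt. Qed.

Lemma witt_class_cons a s : witt_class (a :: s) = e a + witt_class s.
Proof. exact: (@witt_class_cat F two [:: a]). Qed.

Lemma witt_class_sum s : witt_class s = \sum_(x <- map e s) x.
Proof.
elim: s => [|a s IH] /=; first by rewrite big_nil.
by rewrite big_cons -IH witt_class_cons.
Qed.

Lemma unit_classM a b : e (nzmul a b) = e a * e b.
Proof. by rewrite /unit_class -witt_class_mul. Qed.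

Lemma witt_class_map a s : witt_class (map (nzmul a) s) = e a * witt_class s.
Proof. by rewrite /unit_class -witt_class_mul /form_mul /= cats0. Qed.

Lemma unit_classN a : e (nzopp a) = - e a.
Proof.
apply/eqP; rewrite -addr_eq0 addrC -witt_class_cons; apply/eqP.
exact: ((witt_class_eqP _ [::]).2 (witt_equiv_opp two [:: a])).
Qed.

Lemma unit_class1 : e nz1 = 1. Proof. exact: witt_class_1. Qed.

Lemma iso_unary a b x : (a : F) = (b : F) * x ^+ 2 -> iso [:: a] [:: b].
Proof.
move=> abx; apply: (@congruent_unit F 1 (diag_form [:: a]) (diag_form [:: b]) x%:M).
  rewrite !diag_formE tr_scalar_mx mul_scalar_mx mul_mx_scalar.
  apply/matrixP => i j; rewrite !mxE.
  by case: i => [[|i] //= ilt]; case: j => [[|j] //= jlt]; rewrite abx; ring.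
exact: (diag_form_unit [:: a]).
Qed.

Lemma unit_class_sqr a : e a * e a = 1.
Proof.
rewrite -unit_classM -unit_class1; apply/witt_class_iso/(@iso_unary _ _ (a : F)).
by rewrite /=; ring.
Qed.

(** In the plane <a, b> the vector (1, 1) has value a + b and is orthogonal to
    (b, -a), whose value is a b (a + b). *)
Lemma unit_classD a b c : (c : F) = (a : F) + (b : F) ->
  e a + e b = e c * (1 + e a * e b).
Proof.
have e2 x y : e x + e y = witt_class [:: x; y] by rewrite witt_class_cons.
move=> cab; rewrite mulrDr mulr1 -!unit_classM !e2.
symmetry; apply: witt_class_iso.
by apply: (@iso_binary F _ _ _ _ 1 1 (b : F) (- (a : F))); rewrite /= ?cab; ring.
Qed.

(** ** Pfister forms *)

Fixpoint pfister_form us : seq (nzscalar F) :=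
  if us is u :: us' then pfister_form us' ++ map (nzmul u) (pfister_form us') else [:: nz1].

Lemma witt_class_pfister_cons u us :
  witt_class (pfister_form (u :: us)) = (1 + e u) * witt_class (pfister_form us).
Proof. by rewrite /= witt_class_cat witt_class_map mulrDl mul1r. Qed.

Lemma witt_class_pfister us : witt_class (pfister_form us) = pfister (map e us).
Proof.
elim: us => [|u us IH]; first by rewrite /pfister big_nil witt_class_1.
by rewrite witt_class_pfister_cons IH /= pfister_cons.
Qed.

(** Roundness, by induction.  If c = d + u d' with d and d' values of the smaller
    form p, then <d> p = <d'> p = p, whence
    (1 + u) p = (<d> + <u d'>) p = <c> (1 + <d u d'>) p = <c> (1 + u) p. *)
Lemma pfister_form_round us x c : size x = size (pfister_form us) ->
  form_value (pfister_form us) x = (c : F) ->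
  e c * witt_class (pfister_form us) = witt_class (pfister_form us).
Proof.
elim: us x c => [|u us IH] x c.
  case: x => [|x0 [|//]] //= _; rewrite mul1r addr0 => cx.
  rewrite witt_class_1 mulr1 -unit_class1; apply/witt_class_iso/(@iso_unary _ _ x0).
  by rewrite /= mul1r cx.
rewrite witt_class_pfister_cons /= size_cat size_map => sx.
rewrite -[x](cat_take_drop (size (pfister_form us))).
have st : size (take (size (pfister_form us)) x) = size (pfister_form us).
  by rewrite size_takel // sx leq_addr.
have sd : size (drop (size (pfister_form us)) x) = size (pfister_form us).
  by rewrite size_drop sx addKn.
rewrite form_value_cat // form_value_map; move: (take _ _) (drop _ _) st sd => y z sy sz.
set p := witt_class (pfister_form us) in IH *.
have [y0|y0] := eqVneq (form_value (pfister_form us) y) 0;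
  have [z0|z0] := eqVneq (form_value (pfister_form us) z) 0.
- by move=> /esym/eqP; rewrite y0 z0 mulr0 addr0 (negPf (nzval_neq0 c)).
- rewrite y0 add0r => cz; pose d := NzScalar z0.
  have -> : e c = e u * e d by rewrite -unit_classM; congr e; apply: val_inj; rewrite /= -cz.
  have dp : e d * p = p by apply: IH sz _.
  rewrite mulrCA -mulrA dp; have uu := unit_class_sqr u.
  by rewrite mulrA mulrDl mul1r uu addrC.
- rewrite z0 mulr0 addr0 => cy.
  by rewrite mulrCA (IH y c sy cy).
pose d := NzScalar y0; pose d' := NzScalar z0.
have dp : e d * p = p by apply: IH sy _.
have dp' : e d' * p = p by apply: IH sz _.
move=> cE; have := @unit_classD d (nzmul u d') c (esym cE); rewrite unit_classM => H.
transitivity ((e d + e u * e d') * p).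
  rewrite H; transitivity (e c * (p + e u * (e d' * (e d * p)))); last by ring.
  by rewrite dp dp'; ring.
by rewrite mulrDl dp -mulrA dp' mulrDl mul1r.
Qed.

(** If the smaller form p is anisotropic, an isotropic vector of (1 + u) p gives
    values d and d' of p with d = - u d', and roundness turns <d> p = - <u d'> p
    into p = - <u> p. *)
Lemma pfister_form_isotropic us :
  isotropic (pfister_form us) -> witt_class (pfister_form us) = 0.
Proof.
elim: us => [|u us IH].
  case=> x [] /=; case: x => [|x0 [|//]] //= _; rewrite orbF mul1r addr0 => x0n /eqP.
  by rewrite sqrf_eq0 (negPf x0n).
rewrite witt_class_pfister_cons => -[x [sx x0 ex]]; move: sx x0 ex.
rewrite /= size_cat size_map => sx.
rewrite -[x](cat_take_drop (size (pfister_form us))).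
have st : size (take (size (pfister_form us)) x) = size (pfister_form us).
  by rewrite size_takel // sx leq_addr.
have sd : size (drop (size (pfister_form us)) x) = size (pfister_form us).
  by rewrite size_drop sx addKn.
rewrite form_value_cat // form_value_map has_cat.
move: (take _ _) (drop _ _) st sd => y z sy sz yz0.
have zero : isotropic (pfister_form us) -> (1 + e u) * witt_class (pfister_form us) = 0.
  by move/IH ->; rewrite mulr0.
have [y0|y0] := eqVneq (form_value (pfister_form us) y) 0;
  have [z0|z0] := eqVneq (form_value (pfister_form us) z) 0.
- by move=> _; case/orP: yz0 => n0; apply: zero; [exists y | exists z].
- by move/eqP; rewrite y0 add0r mulf_eq0 (negPf z0) (negPf (nzval_neq0 u)).
- by move/eqP; rewrite z0 mulr0 addr0 (negPf y0).
pose d := NzScalar y0; pose d' := NzScalar z0.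
have dp : e d * witt_class (pfister_form us) = witt_class (pfister_form us)
  by apply: pfister_form_round sy _.
have dp' : e d' * witt_class (pfister_form us) = witt_class (pfister_form us)
  by apply: pfister_form_round sz _.
move=> /eqP; rewrite addr_eq0 => /eqP H.
have : e d = - (e u * e d').
  by rewrite -unit_classM -unit_classN; congr e; apply: val_inj; rewrite /= H.
move/(congr1 ( *%R^~ (witt_class (pfister_form us)))); rewrite dp mulNr -mulrA dp' => Hp.
by rewrite mulrDl mul1r {1}Hp addNr.
Qed.

Definition copies m s := flatten (nseq m s).

Lemma copiesD m k s : copies (m + k) s = copies m s ++ copies k s.
Proof. by rewrite /copies nseqD flatten_cat. Qed.

Lemma witt_class_copies m s : witt_class (copies m s) = m%:R * witt_class s.
Proof.
elim: m => [|m IH]; first by rewrite mul0r.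
by rewrite -add1n copiesD witt_class_cat IH natrD mulrDl /copies /= cats0 mul1r.
Qed.

Lemma size_copies m s : size (copies m s) = (m * size s)%N.
Proof. by elim: m => //= m IH; rewrite /copies /= size_cat IH mulSn. Qed.

Lemma pfister_form_copies m us :
  pfister_form (nseq m nz1 ++ us) = copies (2 ^ m) (pfister_form us).
Proof.
elim: m => [|m IH]; first by rewrite /copies /= cats0.
by rewrite /= IH (eq_map (@nzmul1 F)) map_id -copiesD addnn -mul2n expnS.
Qed.

Lemma size_pfister_form us : (0 < size (pfister_form us))%N.
Proof. by elim: us => //= u us IH; rewrite size_cat addn_gt0 IH. Qed.

(** By Witt cancellation, a form of class 0 is a sum of hyperbolic planes. *)
Lemma witt_class0_isotropic s : (0 < size s)%N -> witt_class s = 0 -> isotropic s.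
Proof.
move=> s0 /(witt_class_eqP s [::]) [k [l]] /= H.
have := iso_size H; rewrite size_cat !size_hyp => ss.
have [l' ll] : exists l', l = (l'.+1 + k)%N by exists (l - k).-1; lia.
move: H; rewrite ll hypD => /(iso_cancel two) H.
exact: isotropic_iso H (isotropic_hyp l').
Qed.

(** The m copies of the form sit inside 2^m copies of it, which form a Pfister
    form; the latter is isotropic since the former are, hence hyperbolic. *)
Lemma pfister_form_torsion us m : (0 < m)%N -> m%:R * witt_class (pfister_form us) = 0 ->
  2 ^+ m * witt_class (pfister_form us) = 0.
Proof.
move=> m0 H; have : isotropic (copies m (pfister_form us)).
  apply: witt_class0_isotropic; last by rewrite witt_class_copies.
  by rewrite size_copies muln_gt0 m0 size_pfister_form.
move=> /(@isotropic_cat _ (copies (2 ^ m - m) (pfister_form us))).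
rewrite -copiesD subnKC; last exact/ltnW/ltn_expl.
rewrite -pfister_form_copies => /pfister_form_isotropic.
by rewrite pfister_form_copies witt_class_copies natrX.
Qed.

Definition is_unit_class (x : W) := exists a, x = e a.

Lemma all_unit_class (us : seq W) : all_in is_unit_class us ->
  exists s, us = map e s.
Proof.
elim: us => [|x us IH]; first by exists [::].
by move=> /all_in_cons_inv[[a ->] /IH[s ->]]; exists (a :: s).
Qed.

Lemma all_unit_class_map s : all_in is_unit_class (map e s).
Proof. by move=> x /mapP[a _ ->]; exists a. Qed.

(** ** Cancellation of a factor of odd dimension *)
Lemma witt_class_odd_factor s t : odd (size t) ->
  witt_class s * witt_class t = 0 -> witt_class s = 0.
Proof.
move=> odd_t; rewrite !witt_class_sum; apply: (@odd_sum_regular W is_unit_class).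
- by move=> _ [a ->]; apply: unit_class_sqr.
- by move=> _ [a ->]; exists (nzopp a); rewrite unit_classN.
- move=> us m /all_unit_class[u ->] m0 H; exists m.
  rewrite -witt_class_pfister; apply: pfister_form_torsion => //.
  by rewrite witt_class_pfister.
- exact: all_unit_class_map.
- exact: all_unit_class_map.
- by rewrite size_map.
Qed.

(** The difference of the two forms, multiplied by t, vanishes in the Witt ring;
    equality of Witt classes is isometry because the dimensions agree. *)
Lemma iso_odd_factor s t c : odd (size t) ->
  iso (map (nzmul c) (form_mul s t)) (form_mul s t) ->
  iso (map (nzmul c) s) s.
Proof.
move=> odd_t /witt_class_iso; rewrite witt_class_map witt_class_mul mulrA -witt_class_map => H.
have /(witt_class_odd_factor odd_t) :
    witt_class (map (nzmul c) s ++ map (nzopp (F:=F)) s) * witt_class t = 0.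
  have wN r : witt_class (map (nzopp (F:=F)) r) = - witt_class r.
    apply/eqP; rewrite -addr_eq0 addrC -witt_class_cat; apply/eqP.
    exact: ((witt_class_eqP _ [::]).2 (witt_equiv_opp two r)).
  by rewrite witt_class_cat wN mulrDl H mulNr subrr.
have -> : witt_class (map (nzmul c) s ++ map (nzopp (F:=F)) s) =
    witt_class (map (nzmul c) s) - witt_class s.
  rewrite witt_class_cat; congr (_ + _); apply/eqP; rewrite -addr_eq0 addrC -witt_class_cat.
  apply/eqP; exact: ((witt_class_eqP _ [::]).2 (witt_equiv_opp two s)).
move/eqP; rewrite subr_eq0 => /eqP/witt_class_eqP[k [l Hkl]].
have := iso_size Hkl; rewrite !size_cat !size_hyp size_map => /addnI/double_inj kl.
by rewrite kl in Hkl; apply: iso_cancel Hkl.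
Qed.

(** ** Multipliers of a tensor product *)

Lemma congruent_diag_form n (A : 'M[F]_n) : A^T = A -> A \in unitmx ->
  exists2 s, size s = n & congruent A (diag_form s).
Proof.
move=> As Au; have [D [d [Dd Du d0]]] := diagonalization two As Au.
pose f i : nzscalar F := NzScalar (d0 i).
exists [seq f i | i <- enum 'I_n]; first by rewrite size_map size_enum_ord.
apply: (@congruent_trans _ _ n _ _ (diag_mx d)).
  apply: congruent_sym; apply: (congruent_unit Dd).
  by rewrite -Dd !unitmx_mul unitmx_tr Du Au.
rewrite diag_formE; apply: congruent_diag; first by rewrite size_map size_enum_ord.
move=> i j ij; rewrite mxE -ij (nth_map i) ?size_enum_ord //.
by rewrite nth_ord_enum.
Qed.

Lemma nth_form_mul s t i j : (i < size s)%N -> (j < size t)%N ->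
  nth nz1 (form_mul s t) (i * size t + j) = nzmul (nth nz1 s i) (nth nz1 t j).
Proof.
elim: s i => //= a s IH [|i] ilt jlt; rewrite /form_mul /= nth_cat size_map.
  by rewrite jlt (nth_map nz1).
by rewrite mulSn -addnA ltnNge leq_addr /= addKn IH.
Qed.

Lemma congruent_form_mul s t :
  congruent (diag_form (form_mul s t)) (tensmx (diag_form s) (diag_form t)).
Proof.
have -> : tensmx (diag_form s) (diag_form t) = diag_mx (\row_k
    ((nth nz1 s (mxtens_unindex k).1 : F) * (nth nz1 t (mxtens_unindex k).2 : F))).
  apply/matrixP => i j; case: (mxtens_indexP i) => i1 i2.
  case: (mxtens_indexP j) => j1 j2; rewrite tensmxE !diag_formE !mxE mxtens_indexK /=.
  rewrite (can_eq (@mxtens_indexK _ _)) xpair_eqE.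
  by case: eqP; case: eqP => //=; rewrite ?mulr1n ?mulr0n ?mulr0 ?mul0r.
rewrite diag_formE; apply: congruent_diag; first by rewrite size_allpairs.
move=> i j ij; rewrite !mxE ij -[j in LHS](mxtens_unindexK j).
by case: (mxtens_unindex j) => j1 j2; rewrite nth_form_mul.
Qed.

Lemma congruent_simP n (A : 'M[F]_n) (c : F) : A \in unitmx -> c != 0 ->
  (exists g, sim A g c) <-> congruent (c *: A) A.
Proof.
move=> Au c0; split=> [[g Hg]|[P [Q [_ _ H]]]]; last by exists P.
apply: congruent_unit Hg _; rewrite -mul_scalar_mx unitmx_mul Au andbT.
by rewrite unitmxE det_scalar unitfE expf_neq0.
Qed.

Lemma sim_odd_factor n m (A : 'M[F]_n) (B : 'M[F]_m) (c : F) :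
  A^T = A -> A \in unitmx -> B^T = B -> B \in unitmx -> odd m -> c != 0 ->
  (exists g, sim (tensmx A B) g c) <-> (exists g, sim A g c).
Proof.
move=> As Au Bs Bu odd_m c0; split; last first.
  move=> [g Hg]; exists (tensmx g 1%:M).
  rewrite /sim trmx_tens !tensmx_mul trmx1 mulmx1 mul1mx Hg.
  by apply/matrixP => i j; rewrite !mxE mulrA.
have [s _ As'] := congruent_diag_form As Au; have [t tm Bt] := congruent_diag_form Bs Bu.
rewrite (congruent_simP (unitmx_tens Au Bu) c0) (congruent_simP Au c0) => H.
pose nc := NzScalar c0.
have H1 : iso (map (nzmul nc) s) s.
  apply: (@iso_odd_factor _ t); first by rewrite tm.
  have E := congruent_trans (congruent_form_mul s t)
              (congruent_sym (congruent_tens As' Bt)).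
  apply: congruent_trans (congruent_scale nc _) _.
  apply: congruent_trans (congruentZ c E) _.
  exact: congruent_trans H (congruent_sym E).
apply: congruent_trans (congruentZ c As') _.
apply: congruent_trans (congruent_sym (congruent_scale nc s)) _.
exact: congruent_trans H1 (congruent_sym As').
Qed.

End OddFactor.

(** * Proper similitudes *)

(** The group of projective similitudes is connected in odd dimension, and in even
    dimension the determinant distinguishes its two components. *)
Definition proper (R : comNzRingType) n (g : 'M[R]_n) (c : R) : Prop :=
  odd n \/ \det g = c ^+ n./2.

Section Proper.
Variable R : comNzRingType.

Lemma proper_comp n (g h : 'M[R]_n) c d :
  proper g c -> proper h d -> proper (g *m h) (c * d).
Proof.
move=> [on|gc] [on'|hd]; try by left.
by right; rewrite det_mulmx gc hd exprMn.
Qed.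

Lemma proper1 n : proper (1%:M : 'M[R]_n) 1.
Proof. by right; rewrite det1 expr1n. Qed.

Lemma properZ n (g : 'M[R]_n) a c : proper g c -> proper (a *: g) (a ^+ 2 * c).
Proof.
have [on _|en [on|gc]] := boolP (odd n); first by left.
  by rewrite on in en.
right; rewrite detZ gc exprMn -exprM; congr (_ ^+ _ * _).
by rewrite mul2n -[LHS]odd_double_half (negPf en).
Qed.

Lemma proper_map (S : comNzRingType) (f : {rmorphism R -> S}) n (g : 'M[R]_n) c :
  proper g c -> proper (map_mx f g) (f c).
Proof.
by move=> [on|gc]; [left | right; rewrite det_map_mx gc rmorphXn].
Qed.

End Proper.

Lemma proper_map_inj (R S : comNzRingType) (f : {rmorphism R -> S}) n (g : 'M[R]_n) c :
  injective f -> proper (map_mx f g) (f c) -> proper g c.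
Proof.
move=> finj [on|gc]; [by left | right; apply: finj].
by rewrite -det_map_mx gc rmorphXn.
Qed.

Section Similitudes.
Variables (F : fieldType) (n : nat) (B : 'M[F]_n).
Hypotheses (two : (2 : F) != 0) (Bsym : B^T = B) (Bunit : B \in unitmx).
Implicit Types g h : 'M[F]_n.

Lemma sim_unit g c : c != 0 -> sim B g c -> g \in unitmx.
Proof.
move=> c0 gB; have : c *: B \in unitmx.
  rewrite -mul_scalar_mx unitmx_mul Bunit andbT.
  by rewrite unitmxE det_scalar unitfE expf_neq0.
by rewrite -gB !unitmx_mul => /andP[/andP[]].
Qed.

Lemma similitudeP g : similitude B g <-> exists2 c, c != 0 & sim B g c.
Proof.
split=> [[gu [c c0 gB]]|[c c0 gB]]; last first.
  split; first exact: sim_unit gB.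
  exists c => // v; rewrite /qvalue -/(bform B _ _) (simP B g c).2 //.
exists c => //; apply/simP => u v.
have H w : bform B (w *m g) (w *m g) = c * bform B w w := gB w.
have := H (u + v); rewrite mulmxDl !(bformDl, bformDr) !H.
rewrite (bformC (v *m g)) // (bformC v) // => E.
apply: (mulfI two); rewrite mulrCA; apply/eqP; rewrite -subr_eq0; apply/eqP.
move/eqP: E; rewrite -subr_eq0 => /eqP E; rewrite -[RHS]E; ring.
Qed.

Lemma sim_det g c : sim B g c -> (\det g) ^+ 2 = c ^+ n.
Proof.
move/(congr1 determinant); rewrite !det_mulmx det_tr detZ.
have d0 : \det B != 0 by rewrite -unitfE -unitmxE.
by rewrite mulrAC => /(mulIf d0); rewrite expr2.
Qed.

Lemma sim_det_sign g c : ~~ odd n -> sim B g c ->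
  \det g = c ^+ n./2 \/ \det g = - c ^+ n./2.
Proof.
move=> en /sim_det H.
have : \det g ^+ 2 == (c ^+ n./2) ^+ 2.
  rewrite H -exprM muln2; apply/eqP; congr (_ ^+ _).
  by rewrite -[LHS]odd_double_half (negPf en).
by rewrite eqf_sqr => /orP[/eqP|/eqP]; [left|right].
Qed.

Lemma exists_anisotropic : (0 < n)%N -> exists v, qvalue B v != 0.
Proof.
case: n B Bsym Bunit => // k B' sym unit _.
apply: anisotropic_vector => //; apply: contraTneq unit => ->.
by rewrite unitmxE det0 unitr0.
Qed.

(** The same reflection serves all similitudes, so it can correct a whole
    polynomial family at once. *)
Lemma make_proper : (0 < n)%N -> exists2 r, sim B r 1 &
  forall g c, sim B g c -> proper g c \/ proper (g *m r) c.
Proof.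
move=> n0; have [v v0] := exists_anisotropic n0.
exists (refl B v); first exact: refl_sim.
move=> g c gB; have [on|en] := boolP (odd n); first by left; left.
have [gc|gc] := sim_det_sign en gB; first by left; right.
by right; right; rewrite det_mulmx det_refl // gc mulrN1 opprK.
Qed.

Lemma sim_proper g c : (0 < n)%N -> sim B g c -> exists2 h, sim B h c & proper h c.
Proof.
move=> n0 gB; have [r rB /(_ g c gB)[|]] := make_proper n0; first by exists g.
by exists (g *m r) => //; rewrite -[c]mulr1; apply: sim_comp.
Qed.

Lemma sim_inv g c : c != 0 -> sim B g c -> sim B (invmx g) c^-1.
Proof.
move=> c0 gB; have gu := sim_unit c0 gB.
have E : invmx g *m (g *m B *m g^T) *m (invmx g)^T = B.
  rewrite !mulmxA mulVmx // mul1mx -(mulmxA B) -trmx_mul mulVmx //.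
  by rewrite trmx1 mulmx1.
rewrite /sim -[in RHS]E gB -scalemxAr -scalemxAl scalerA mulVf //.
by rewrite scale1r.
Qed.

End Similitudes.

(** * Polynomial paths *)

Section Paths.
Variables (F : fieldType) (n : nat) (B : 'M[F]_n).
Hypotheses (two : (2 : F) != 0) (Bsym : B^T = B) (Bunit : B \in unitmx).
Implicit Types g h : 'M[F]_n.

Local Notation Bp := (map_mx polyC B).
Local Notation eval a := (map_mx (horner_eval (a : F))).

(** A polynomial family of similitudes is an R-link between its ends, and over
    an algebraically closed field its values form a connected set. *)
Definition path_at (P : 'M[{poly F}]_n) (m : {poly F}) g h : Prop :=
  [/\ sim Bp P m, proper P m, m.[0] != 0 /\ m.[1] != 0,
      eval 0 P = g & eval 1 P = h].

Definition path g h : Prop := exists P m, path_at P m g h.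

Definition chain := clos_refl_sym_trans 'M[F]_n path.

Lemma eval_polyC a g : eval a (map_mx polyC g) = g.
Proof.
rewrite -map_mx_comp map_mx_id // => x /=; exact: hornerC.
Qed.

Lemma sim_eval a P m : sim Bp P m -> sim B (eval a P) m.[a].
Proof.
by move=> /(@sim_map _ _ _ (horner_eval a)); rewrite eval_polyC.
Qed.

Lemma path_scale g c l : c != 0 -> l != 0 -> sim B g c -> proper g c ->
  path g (l *: g).
Proof.
move=> c0 l0 gB gp; pose s : {poly F} := 1 - 'X + l *: 'X.
have s0 : s.[0] = 1 by rewrite !hornerE; ring.
have s1 : s.[1] = l by rewrite !hornerE; ring.
exists (s *: map_mx polyC g), (s ^+ 2 * c%:P); split.
- exact/simZ/sim_map.
- exact/properZ/proper_map.
- by rewrite !hornerM s0 s1 !hornerC !mulf_neq0 ?oner_eq0.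
- by rewrite map_mxZ /= eval_polyC /horner_eval s0 scale1r.
- by rewrite map_mxZ /= eval_polyC /horner_eval s1.
Qed.

(** The square of det P is m^n, so det P is m^(n/2) or - m^(n/2); the value at 0
    decides between them. *)
Lemma proper_at0 P m : sim Bp P m -> m.[0] != 0 -> proper (eval 0 P) m.[0] ->
  proper P m.
Proof.
move=> PB m0 P0; have [on|en] := boolP (odd n); first by left.
have d0 : \det Bp != 0.
  by rewrite det_map_mx polyC_eq0 -unitfE -unitmxE.
have : \det P ^+ 2 == (m ^+ n./2) ^+ 2.
  rewrite -exprM muln2 (even_halfK en).
  have /(congr1 determinant) := PB; rewrite !det_mulmx det_tr detZ mulrAC.
  by move/(mulIf d0); rewrite expr2 => ->.
rewrite eqf_sqr => /orP[/eqP|/eqP Pm]; first by right.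
case: P0 => [on|]; first by rewrite on in en.
rewrite det_map_mx Pm /= /horner_eval hornerN horner_exp => /eqP.
by rewrite eq_sym -addr_eq0 -mulr2n -mulr_natl mulf_eq0 (negPf two) expf_eq0 (negPf m0) andbF.
Qed.

(** This is q(w) times the reflection in w, and it makes sense for a vector of
    polynomials. *)
Definition scaled_refl (R : comNzRingType) (A : 'M[R]_n) (w : 'rV[R]_n) : 'M[R]_n :=
  (bform A w w)%:M - 2 *: (A *m w^T *m w).

Lemma scaled_reflE w : qvalue B w != 0 ->
  scaled_refl B w = qvalue B w *: refl B w.
Proof.
move=> w0; rewrite /scaled_refl /refl scalerBr scalemx1; congr (_ - _).
by rewrite -scalemxAl scalerA mulrCA divff // mulr1.
Qed.

Lemma scaled_refl_sim (R : comNzRingType) (A : 'M[R]_n) w : A^T = A ->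
  sim A (scaled_refl A w) (bform A w w ^+ 2).
Proof.
move=> As; have act v : v *m scaled_refl A w = bform A w w *: v - (2 * bform A v w) *: w.
  rewrite /scaled_refl mulmxBr mul_mx_scalar -scalemxAr !mulmxA; congr (_ - _).
  by rewrite [v *m A *m _]mx11_scalar mul_scalar_mx scalerA.
apply/simP => u v; rewrite !act !(bformDl, bformDr, bformNl, bformNr, bformZl, bformZr).
rewrite (bformC w v) //; ring.
Qed.

Lemma scaled_refl_map (R S : comNzRingType) (f : {rmorphism R -> S}) A w :
  map_mx f (scaled_refl A w) = scaled_refl (map_mx f A) (map_mx f w).
Proof.
rewrite /scaled_refl map_mxB map_scalar_mx map_mxZ !map_mxM map_trmx rmorphMn rmorph1.
congr (_%:M - _); rewrite /bform map_trmx -!map_mxM.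
by rewrite !mxE.
Qed.


(** Let w go from u to v along a segment, in the family q(w) s_u s_w of
    similitudes; only at the ends does q(w) have to be nonzero. *)
Lemma path_refl_pair g c u v : c != 0 -> sim B g c -> proper g c ->
  qvalue B u != 0 -> qvalue B v != 0 ->
  path (qvalue B u *: g) (qvalue B v *: (g *m (refl B u *m refl B v))).
Proof.
move=> c0 gB gp u0 v0.
pose w : 'rV[{poly F}]_n := (1 - 'X) *: map_mx polyC u + 'X *: map_mx polyC v.
have w0 : eval 0 w = u.
  by apply/rowP => i; rewrite !mxE /horner_eval !hornerE; ring.
have w1 : eval 1 w = v.
  by apply/rowP => i; rewrite !mxE /horner_eval !hornerE; ring.
have wa a : (bform Bp w w).[a] = qvalue B (eval a w).
  rewrite /qvalue -[in RHS](eval_polyC a B) map_trmx -!map_mxM.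
  by rewrite [RHS]mxE.
have mE a : (c%:P * bform Bp w w ^+ 2).[a] = c * qvalue B (eval a w) ^+ 2.
  by rewrite hornerM hornerC horner_exp wa.
have ru : sim B (refl B u) 1 by apply: refl_sim.
pose g' := g *m refl B u.
have g'B : sim B g' c by rewrite -[c]mulr1; apply: sim_comp.
exists (map_mx polyC g' *m scaled_refl Bp w), (c%:P * bform Bp w w ^+ 2); split.
- apply: sim_comp; first exact: sim_map.
  by apply: scaled_refl_sim; rewrite map_trmx Bsym.
- apply: proper_at0.
  + by apply: sim_comp; [exact: sim_map | apply: scaled_refl_sim; rewrite map_trmx Bsym].
  + by rewrite mE w0 mulf_neq0 // expf_neq0.
  + rewrite map_mxM /= eval_polyC scaled_refl_map eval_polyC w0 scaled_reflE //.
    rewrite -scalemxAr -mulmxA reflK // mulmx1 mE w0.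
    by rewrite mulrC; apply: properZ.
- by rewrite !mE w0 w1 !mulf_neq0 ?expf_neq0.
- rewrite map_mxM /= eval_polyC scaled_refl_map eval_polyC w0 scaled_reflE //.
  by rewrite -scalemxAr -mulmxA reflK // mulmx1.
rewrite map_mxM /= eval_polyC scaled_refl_map eval_polyC w1 scaled_reflE //.
by rewrite -scalemxAr -mulmxA.
Qed.

Lemma chain_refl_pair g c u v : c != 0 -> sim B g c -> proper g c ->
  qvalue B u != 0 -> qvalue B v != 0 ->
  chain g (g *m (refl B u *m refl B v)).
Proof.
move=> c0 gB gp u0 v0.
have rB : sim B (refl B u *m refl B v) 1.
  by rewrite -[1]mulr1; apply: sim_comp; apply: refl_sim.
have rp : proper (refl B u *m refl B v) 1.
  by right; rewrite det_mulmx !det_refl // expr1n mulrNN mulr1.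
apply: (rst_trans _ _ _ (qvalue B u *: g)).
  exact/rst_step/(path_scale c0).
apply: (rst_trans _ _ _ (qvalue B v *: (g *m (refl B u *m refl B v)))).
  exact/rst_step/(path_refl_pair c0).
apply/rst_sym/rst_step/(path_scale c0 v0); rewrite -[c]mulr1.
  exact: sim_comp.
exact: proper_comp.
Qed.

Lemma chain_prodrefl g c us : c != 0 -> sim B g c -> proper g c ->
  anisotropic_seq B us -> ~~ odd (size us) -> chain g (g *m prodrefl B us).
Proof.
move=> c0; have [k] := ubnP (size us).
elim: k us g => // k IH [|u [|v us]] g //= us_k gB gp.
  by move=> _ _; rewrite mulmx1; apply: rst_refl.
rewrite negbK => /and3P[u0 v0 us0] us_even.
rewrite !mulmxA -(mulmxA g).
apply: rst_trans (chain_refl_pair c0 gB gp u0 v0) _.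
apply: IH => //; first by rewrite ltnS in us_k; apply: leq_trans us_k.
  by rewrite -[c]mulr1; apply: sim_comp gB _; rewrite -[1]mulr1;
     apply: sim_comp; apply: refl_sim.
rewrite -[c]mulr1; apply: proper_comp => //.
by right; rewrite det_mulmx !det_refl // expr1n mulrNN mulr1.
Qed.

(** Up to the sign, which matters in odd dimension, proper similitudes with the
    same multiplier differ by a product of an even number of reflections. *)
Lemma chain_same_multiplier g h c : c != 0 ->
  sim B g c -> proper g c -> sim B h c -> proper h c -> chain g h.
Proof.
move=> c0 gB gp hB hp.
have gu := sim_unit Bunit c0 gB.
wlog rdet : h hB hp / \det (invmx g *m h) = 1.
  move=> wlh; have rB : sim B (invmx g *m h) 1.
    by rewrite -(mulVf c0); apply: sim_comp => //; apply: sim_inv.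
  have := sim_det Bunit rB; rewrite expr1n => /eqP; rewrite sqrf_eq1.
  case/orP => /eqP rdet; first exact: wlh.
  have [on|en] := boolP (odd n); last first.
    case: gp => [on|gd]; first by rewrite on in en.
    case: hp => [on|hd]; first by rewrite on in en.
    move: rdet; rewrite det_mulmx det_inv gd hd mulVf ?expf_neq0 // => /eqP.
    by rewrite -addr_eq0 (negPf two).
  have hB' : sim B (- 1 *: h) c by have := simZ (- 1) hB; rewrite sqrrN expr1n mul1r.
  apply: (rst_trans _ _ _ (- 1 *: h)).
    apply: wlh => //; first by left.
    by rewrite -scalemxAr detZ rdet -signr_odd on expr1 mulrNN mulr1.
  by apply/rst_sym/rst_step/(path_scale c0); rewrite // oppr_eq0 oner_eq0.
have rB : sim B (invmx g *m h) 1.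
  by rewrite -(mulVf c0); apply: sim_comp => //; apply: sim_inv.
have [us us0 rE] := cartan_dieudonne two Bsym Bunit rB.
have -> : h = g *m prodrefl B us by rewrite -rE mulKVmx.
apply: (@chain_prodrefl g c) => //.
move: rdet; rewrite rE det_prodrefl // -signr_odd; case: (odd _) => // /eqP.
by rewrite expr1 eq_sym -addr_eq0 (negPf two).
Qed.

End Paths.

(** * The identity component *)

Section Zariski.
Local Open Scope classical_set_scope.
Variables (F : fieldType) (n : nat).
Local Notation Z := (zariski_mx F n).

Definition mx_eval (p : {mpoly F[n * n]}) (g : 'M[F]_n) : F :=
  p.@[fun k => mxvec g 0 k].

Lemma zariski_open_mx_eval d (p : {mpoly F[n * n]}) : p \is d.-homog ->
  open ([set g | mx_eval p g != 0] : set Z).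
Proof.
move=> ph; exists [set [set g : Z | mx_eval p g != 0]]; last by rewrite bigcup_set1.
move=> _ ->; apply: finI_from1; exists d, p; by split.
Qed.

Lemma zariski_basicI (U V : set Z) : zariski_basic_open U ->
  zariski_basic_open V -> zariski_basic_open (U `&` V).
Proof.
move=> [d [p [ph ->]]] [e [q [qh ->]]]; exists (d + e)%N, (p * q).
split; first exact: dhomogM.
apply/seteqP; split=> g /=; rewrite mevalM mulf_eq0 negb_or.
  by move=> [-> ->].
by move/andP.
Qed.

Lemma zariski_basic_bigcap (s : seq (set Z)) :
  (forall U, U \in s -> zariski_basic_open U) ->
  zariski_basic_open (\bigcap_(U in [set` s]) U).
Proof.
elim: s => [|U s IH] H.
  exists 0%N, 1; split; first exact: dhomog1.
  by apply/seteqP; split=> g //= _; rewrite meval1 oner_eq0.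
have -> : \bigcap_(V in [set` U :: s]) V = U `&` \bigcap_(V in [set` s]) V.
  apply/seteqP; split=> [g Hg|g [Ug Hg] V /=].
    split=> [|V /= Vs]; apply: Hg; rewrite /= inE ?eqxx //.
    by rewrite Vs orbT.
  by rewrite inE => /orP[/eqP -> //|Vs]; apply: Hg.
apply: zariski_basicI; first by apply: H; rewrite mem_head.
by apply: IH => V Vs; apply: H; rewrite inE Vs orbT.
Qed.

Lemma zariski_open_basic (U : set Z) g : open U -> U g ->
  exists V : set Z, [/\ zariski_basic_open V, V g & V `<=` U].
Proof.
move=> [D DU <-] [V DV Vg]; have [fs fsb fsV] := DU _ DV.
exists V; split=> //; last by move=> h Vh; exists V.
rewrite -fsV; have := @zariski_basic_bigcap (finmap.enum_fset fs).
suff -> : \bigcap_(U in [set` finmap.enum_fset fs]) U =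
  \bigcap_(i in [set` fs]) isSubBaseTopological.b i.
  by apply => W Wfs; have := fsb W Wfs; rewrite inE.
by apply/seteqP; split=> x Hx W /= Wfs; apply: Hx.
Qed.

Lemma irreducible_connected (A : set Z) :
  (forall U V, zariski_basic_open U -> zariski_basic_open V ->
    A `&` U !=set0 -> A `&` V !=set0 -> A `&` (U `&` V) !=set0) ->
  connected A.
Proof.
move=> irr B [b0 Bb0] [U Uo BU] [C Cc BC]; apply: contrapT => BA.
have [a [Aa Ca]] : exists a, A a /\ ~ C a.
  apply: contrapT => H; apply: BA; rewrite BC; apply/seteqP; split=> [a []//|a Aa].
  by split=> //; apply: contrapT => Ca; apply: H; exists a.
have [Ab0 Ub0] : (A `&` U) b0 by rewrite -BU.
have [U' [Ub U'b0 U'U]] := zariski_open_basic Uo Ub0.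
have CCo : open (~` C) by exact: closed_openC.
have [V' [Vb V'a V'C]] := zariski_open_basic CCo Ca.
have [||x [Ax [U'x V'x]]] := irr U' V' Ub Vb; [by exists b0 | by exists a | ].
have : B x by rewrite BU; split=> //; apply: U'U.
by rewrite BC => -[_]; apply: V'C.
Qed.

End Zariski.

Section PathsConnect.
Local Open Scope classical_set_scope.
Variables (F : closedFieldType) (n : nat) (B : 'M[F]_n).
Hypotheses (two : (2 : F) != 0) (Bsym : B^T = B) (Bunit : B \in unitmx).
Local Notation Z := (zariski_mx F n).

Lemma meval_path (p : {mpoly F[n * n]}) (P : 'M[{poly F}]_n) :
  exists r : {poly F}, forall a,
    p.@[fun k => mxvec (map_mx (horner_eval a) P) 0 k] = r.[a].
Proof.
exists (\sum_(m <- msupp p) p@_m *: \prod_i (mxvec P 0 i) ^+ m i) => a.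
rewrite mevalE horner_sum; apply: eq_bigr => m _.
rewrite hornerZ horner_prod; congr (_ * _); apply: eq_bigr => i _.
by rewrite horner_exp -map_mxvec mxE.
Qed.

(** The values of the family at the parameters where m does not vanish form an
    irreducible set: a homogeneous polynomial restricts to a polynomial in the
    parameter, and nonzero polynomials have a common non-root. *)
Lemma path_component g h : path B g h ->
  connected_component ([set x | similitude B x] : set Z) g h.
Proof.
move=> [P [m [PB Pp [m0 m1] P0 P1]]].
pose A : set Z := [set x | exists a, m.[a] != 0 /\ map_mx (horner_eval a) P = x].
apply: (@connected_component_max _ _ A g); last by exists 1.
- by exists 0.
- move=> _ [a [ma <-]]; apply/similitudeP => //; exists m.[a] => //.
  exact: sim_eval.
apply: irreducible_connected => U V [d [p [_ ->]]] [e [q [_ ->]]].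
move=> [_ [[a [ma <-]] /= pa]] [_ [[b [mb <-]] /= qb]].
have [r rE] := meval_path p P; have [s sE] := meval_path q P.
rewrite rE in pa; rewrite sE in qb.
have : m * r * s != 0.
  rewrite !mulf_neq0 //; first by apply: contra_neq m0 => ->; rewrite horner0.
    by apply: contra_neq pa => ->; rewrite horner0.
  by apply: contra_neq qb => ->; rewrite horner0.
move/closed_nonrootP => [x]; rewrite /root !hornerM !mulf_eq0 !negb_or.
move=> /andP[/andP[mx rx] sx]; exists (map_mx (horner_eval x) P).
by split; [exists x | rewrite /= rE sE].
Qed.

Lemma chain_component g h : similitude B g -> chain B g h ->
  connected_component ([set x | similitude B x] : set Z) g h.
Proof.
move=> gS gh; suff [_ H] : (similitude B g <-> similitude B h) /\
    (similitude B g -> connected_component ([set x | similitude B x] : set Z) g h).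
  exact: H.
elim: gh {gS} => [x y xy|x|x y _ [e IH]|x y z _ [e1 IH1] _ [e2 IH2]].
- have xyc := path_component xy; split=> //; split=> _.
    exact: (connected_component_sub xyc).
  exact: (connected_component_sub (connected_component_sym xyc)).
- by split=> // xS; apply: connected_component_refl.
- by split=> [|yS]; [split; apply e | apply/connected_component_sym/IH/e].
split=> [|xS]; first by split=> [/e1/e2|/e2/e1].
exact: (@connected_component_trans Z _ y _ _ (IH1 xS) (IH2 (e1.1 xS))).
Qed.

Hypothesis n_gt0 : (0 < n)%N.

(** Over an algebraically closed field, a multiple of g has multiplier 1, the
    multiplier of the identity. *)
Lemma proper_component g c : c != 0 -> sim B g c -> proper g c ->
  connected_component ([set x | similitude B x] : set Z) 1%:M g.
Proof.
move=> c0 gB gp; have [l lc] : exists l : F, l ^+ 2 = c.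
  have [l] := @solve_monicpoly F 2 (fun k => if k == 0%N then c else 0) isT.
  by rewrite !big_ord_recl big_ord0 /= expr0 mulr1 mul0r !addr0 => <-; exists l.
have l0 : l != 0 by apply: contra_neq c0 => l0; rewrite -lc l0 expr0n.
have one1 : sim B 1%:M 1 := sim1 B.
apply: chain_component.
  by apply/similitudeP => //; exists 1; rewrite ?oner_eq0.
apply: (rst_trans _ _ _ (l *: 1%:M)).
  by apply/rst_step/(path_scale (oner_neq0 F)) => //; apply: proper1.
apply: (chain_same_multiplier two Bsym Bunit c0 _ _ gB gp).
  by have := simZ l one1; rewrite lc mulr1.
by have := properZ l (proper1 F n); rewrite lc mulr1.
Qed.

Definition generic_mx : 'M[{mpoly F[n * n]}]_n := vec_mx (\row_k 'X_k).

Lemma generic_mx_eval (g : 'M[F]_n) :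
  map_mx (meval (fun k => mxvec g 0 k)) generic_mx = g.
Proof.
rewrite /generic_mx map_vec_mx; apply: (canLR mxvecK).
by apply/rowP => k; rewrite !mxE mevalXU.
Qed.

Lemma generic_mx_homog i j : generic_mx i j \is 1.-homog.
Proof. rewrite /generic_mx !mxE dhomogX; apply/eqP; exact: mdeg1. Qed.

Lemma det_homog : \det generic_mx \is n.-homog.
Proof.
rewrite rpred_sum // => s _; rewrite rpredMsign.
suff : \prod_(i < n) generic_mx i (perm.fun_of_perm s i)
    \is (\sum_(i < n) 1)%N.-homog by rewrite sum1_card card_ord.
elim/big_ind2: _ => [|p d q e ph qh|i _]; first exact: dhomog1.
  exact: dhomogM.
exact: generic_mx_homog.
Qed.

(** In even dimension det = mu^(n/2) or det = - mu^(n/2) on similitudes, where the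
    multiplier mu is a quadratic polynomial in the entries.  Each set is open in
    the similitudes, as the non-vanishing locus of the equation of the other. *)
Lemma proper_of_component g c : sim B g c ->
  connected_component ([set x | similitude B x] : set Z) 1%:M g -> proper g c.
Proof.
move=> gB [C [C1 CS Cc] Cg]; have [on|en] := boolP (odd n); first by left.
right.
have [i [j Bij]] : exists i j, B i j != 0.
  apply/matrix0Pn; apply: contraTneq Bunit => ->.
  by rewrite unitmxE -(prednK n_gt0) det0 unitr0.
pose X := generic_mx; pose Bm := map_mx (@mpolyC (n * n) F) B.
pose mu : {mpoly F[n * n]} := (B i j)^-1 *: (X *m Bm *m X^T) i j.
have mu_homog : mu \is 2.-homog.
  rewrite dhomogZ // mxE rpred_sum // => k _; rewrite mxE mulr_suml.
  rewrite rpred_sum // => l _; rewrite [Bm _ _]mxE [X^T _ _]mxE mulrAC mulrC mul_mpolyC.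
  by apply: dhomogZ; apply: (dhomogM (d := 1) (e := 1)); apply: generic_mx_homog.
have mu_eval x d : sim B x d -> mx_eval mu x = d.
  move=> xB; rewrite /mx_eval /mu mevalZ.
  have -> : ((X *m Bm *m X^T) i j).@[fun k => mxvec x 0 k] = (x *m B *m x^T) i j.
    transitivity (map_mx (meval (fun k => mxvec x 0 k)) (X *m Bm *m X^T) i j).
      by rewrite [RHS]mxE.
    rewrite !map_mxM -map_trmx generic_mx_eval; congr ((_ *m _ *m _) _ _).
    by rewrite -map_mx_comp map_mx_id // => y /=; rewrite mevalC.
  by rewrite xB mxE mulrCA mulVf // mulr1.
have det_eval x : mx_eval (\det X) x = \det x.
  by rewrite /mx_eval -det_map_mx generic_mx_eval.
have mun : mu ^+ n./2 \is n.-homog.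
  by rewrite -[n in n.-homog](even_halfK en) -muln2 mulnC; apply: dhomogMn.
pose U : set Z := [set x | mx_eval (\det X + mu ^+ n./2) x != 0].
pose V : set Z := [set x | mx_eval (\det X - mu ^+ n./2) x != 0].
have Uo : open U by apply: (@zariski_open_mx_eval _ _ n); rewrite rpredD ?det_homog.
have Vo : open V by apply: (@zariski_open_mx_eval _ _ n); rewrite rpredB ?det_homog.
have UE x d : sim B x d -> U x <-> \det x + d ^+ n./2 != 0.
  move=> xB; rewrite /U /= /mx_eval mevalD rmorphXn /= -!/(mx_eval _ _).
  by rewrite det_eval (mu_eval x d).
have VE x d : sim B x d -> V x <-> \det x - d ^+ n./2 != 0.
  move=> xB; rewrite /V /= /mx_eval mevalB rmorphXn /= -!/(mx_eval _ _).
  by rewrite det_eval (mu_eval x d).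
have UV x : C x -> U x <-> ~ V x.
  move=> /CS /(similitudeP two Bsym Bunit)[d d0 xB]; rewrite (UE x d) // (VE x d) //.
  have dn0 : d ^+ n./2 != 0 by rewrite expf_neq0.
  have [->|->] := sim_det_sign Bunit en xB.
    rewrite subrr eqxx; split=> // _.
    by rewrite -mulr2n -mulr_natl mulf_neq0.
  rewrite addNr eqxx; split=> // H; exfalso; apply: H.
  by rewrite -opprD oppr_eq0 -mulr2n -mulr_natl mulf_neq0.
have CU : C `&` U = C.
  apply: Cc.
  - exists 1%:M; split=> //; apply/(UE _ 1); first exact: sim1.
    by rewrite det1 expr1n.
  - by exists U.
  exists (~` V); first exact: open_closedC.
  by apply/seteqP; split=> x [Cx Hx]; split=> //; apply/(UV x Cx).
have /(UE _ _ gB) Ug : U g by rewrite -CU in Cg; case: Cg.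
have [//|gd] := sim_det_sign Bunit en gB.
by rewrite gd addNr eqxx in Ug.
Qed.

End PathsConnect.

(** * Algebraically closed extensions of rational function fields *)

(** Ultrapowers preserve the field axioms and the existence of roots, as inverses
    and roots can be chosen for each index separately. *)
Section Ultrapower.
Local Open Scope classical_set_scope.
Local Open Scope quotient_scope.
Variables (I : pointedType) (F : closedFieldType) (U : set_system I).
Hypothesis UU : UltraFilter U.

Definition negligible_fun : {pred I -> F} :=
  fun f => `[< U [set i | f i = 0] >].

Lemma negligible_funP f : reflect (U [set i | f i = 0]) (f \in negligible_fun).
Proof. exact: asboolP. Qed.

Lemma negligible_idealr : idealr_closed negligible_fun.
Proof.
have UF : ProperFilter U by case: UU.
split.
- by apply/negligible_funP; apply: filterS filterT => i _.
- apply/negligible_funP => H; apply: (@filter_not_empty _ U).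
  by apply: filterS H => i /= /eqP; rewrite oner_eq0.
move=> a u v /negligible_funP Hu /negligible_funP Hv; apply/negligible_funP.
by apply: filterS2 Hu Hv => i /= u0 v0; rewrite !fctE u0 v0 mulr0 addr0.
Qed.
HB.instance Definition _ := isIdealr.Build (I -> F) negligible_fun negligible_idealr.

Definition ultrapower := {ideal_quot negligible_fun}.
HB.instance Definition _ := GRing.ComNzRing.on ultrapower.
HB.instance Definition _ := @EqQuotient.on ultrapower.


Local Notation cls f := (\pi_ultrapower f : ultrapower).

Lemma ultrapower_eqP (f g : I -> F) :
  reflect (U [set i | f i = g i]) (cls f == cls g).
Proof.
have -> : (cls f == cls g) = (f - g \in negligible_fun).
  by rewrite -Quotient.idealrBE.
apply: (iffP (negligible_funP _)); have UF : ProperFilter U by case: UU.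
  by apply: filterS => i /= /eqP; rewrite subr_eq0 => /eqP.
by apply: filterS => i /= fg; rewrite !fctE fg subrr.
Qed.

Lemma ultrapower_inverse (x : ultrapower) : x != 0 -> exists y, y * x = 1.
Proof.
move=> x0; have {x0} x0 : cls (repr x) != cls 0 by rewrite reprK rmorph0.
have UF : ProperFilter U by case: UU.
exists (cls (fun i => (repr x i)^-1)).
rewrite -[x in _ * x]reprK -rmorphM -(rmorph1 \pi_ultrapower).
apply/eqP/ultrapower_eqP.
have [] := in_ultra_setVsetC [set i | repr x i = 0] UU.
  by move/ultrapower_eqP; rewrite (negPf x0).
by apply: filterS => i /= /eqP ri; rewrite !fctE mulVf.
Qed.

Definition ultrapower_inv (x : ultrapower) : ultrapower :=
  if pselect (exists y, y * x = 1) is left ex then projT1 (cid ex) else 0.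

Lemma ultrapower_mulVf (x : ultrapower) : x != 0 -> ultrapower_inv x * x = 1.
Proof.
move=> x0; rewrite /ultrapower_inv.
case: pselect => [ex|nex]; last by case: (nex (ultrapower_inverse x0)).
exact: (projT2 (cid ex)).
Qed.

Lemma ultrapower_inv0 : ultrapower_inv 0 = 0.
Proof.
rewrite /ultrapower_inv; case: pselect => // ex; exfalso.
case: ex => y /eqP; by rewrite mulr0 eq_sym oner_eq0.
Qed.

HB.instance Definition _ :=
  GRing.ComNzRing_isField.Build ultrapower ultrapower_mulVf ultrapower_inv0.

Lemma ultrapower_closed : GRing.closed_field_axiom ultrapower.
Proof.
move=> n P n_gt0.
have rootP i : exists x : F, x ^+ n = \sum_(k < n) repr (P k) i * x ^+ k.
  exact: (@solve_monicpoly F n (fun k => repr (P k) i)).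
exists (cls (fun i => projT1 (cid (rootP i)))).
have -> : \sum_(k < n) P k * cls (fun i => projT1 (cid (rootP i))) ^+ k =
  cls (\sum_(k < n) repr (P k) * (fun i => projT1 (cid (rootP i))) ^+ k).
  by rewrite rmorph_sum; apply: eq_bigr => k _; rewrite rmorphM rmorphXn /= reprK.
rewrite -rmorphXn; congr (\pi_ultrapower _); apply/funext => i.
rewrite fct_sumE exprfctE (projT2 (cid (rootP i))); apply: eq_bigr => k _.
by rewrite fctE.
Qed.

HB.instance Definition _ :=
  Field_isAlgClosed.Build ultrapower ultrapower_closed.

End Ultrapower.

Section FractionLift.
Local Open Scope quotient_scope.
Variable R : idomainType.

Lemma fraction_quotient (x : {fraction R}) :
  exists a b : R, b != 0 /\ x = @tofrac R a / @tofrac R b.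
Proof.
elim/quotW: x => r; exists (\n_r), (\d_r); have d0 := denom_ratioP r.
split=> //; apply: (canRL (mulfK _)); first by rewrite tofrac_eq0.
rewrite /tofrac; unlock FracField.tofrac; rewrite -[_ * _]/(FracField.mul _ _).
rewrite -FracField.pi_mul; apply/eqP; rewrite FracField.equivf_def /FracField.mulf.
by rewrite !numden_Ratio ?mulr1 ?oner_eq0 // mulrC.
Qed.

Variables (F : fieldType) (f : {rmorphism R -> F}).
Hypothesis f_inj : injective f.

Lemma fraction_lift :
  exists g : {rmorphism {fraction R} -> F}, forall a, g (@tofrac R a) = f a.
Proof.
have ex x := cid (fraction_quotient x).
pose num x := projT1 (ex x); pose den x := projT1 (cid (projT2 (ex x))).
have den0 x : den x != 0 by case: (projT2 (cid (projT2 (ex x)))).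
have xE x : x = @tofrac R (num x) / @tofrac R (den x).
  by case: (projT2 (cid (projT2 (ex x)))).
have f0 a : a != 0 -> f a != 0 by rewrite -(inj_eq f_inj) rmorph0.
have F0 a : a != 0 -> @tofrac R a != 0 by rewrite tofrac_eq0.
pose g x := f (num x) / f (den x).
have gE a b : b != 0 -> g (@tofrac R a / @tofrac R b) = f a / f b.
  move=> b0; rewrite /g; set x := _ / _.
  apply/eqP; rewrite eqr_div ?f0 // -!rmorphM; apply/eqP; congr (f _).
  apply/eqP; rewrite -tofrac_eq !rmorphM -eqr_div ?F0 //; apply/eqP.
  by rewrite -xE.
have gadd : zmod_morphism g.
  move=> x y; rewrite {1}[x]xE {1}[y]xE -mulNr -rmorphN addf_div ?F0 //.
  rewrite -!rmorphM -rmorphD gE ?mulf_neq0 // !(rmorphD, rmorphM, rmorphN) /=.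
  by rewrite -addf_div ?f0 // mulNr.
have gmul : monoid_morphism g.
  split=> [|x y].
    by rewrite -[1]divr1 -(rmorph1 (@tofrac R)) gE ?oner_eq0 // rmorph1 divr1.
  rewrite {1}[x]xE {1}[y]xE mulf_div -!rmorphM gE ?mulf_neq0 //.
  by rewrite !rmorphM /= -mulf_div.
pose A := GRing.isZmodMorphism.Build _ _ g gadd.
pose M := GRing.isMonoidMorphism.Build _ _ g gmul.
pose G : {rmorphism {fraction R} -> F} := HB.pack g A M.
exists G => a; rewrite -[@tofrac R a]divr1 -(rmorph1 (@tofrac R)) /=.
by rewrite gE ?oner_eq0 // rmorph1 divr1.
Qed.

End FractionLift.

Section ClosedExtension.
Local Open Scope classical_set_scope.
Local Open Scope quotient_scope.

(** Index an ultrapower of Omega by the polynomials p over L, with a point of Omega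
    that is not a root of p at each p != 0, and an ultrafilter containing, for each
    q != 0, the set of nonzero multiples of q.  The class of this family of points
    is then transcendental over L: at all multiples of q, it is not a root of q. *)
Lemma closed_extension_ratfun (L : fieldType) (Omega : closedFieldType)
    (j : {rmorphism L -> Omega}) :
  exists (Omega' : closedFieldType), inhabited {rmorphism {fraction {poly L}} -> Omega'}.
Proof.
pose I : pointedType := HB.pack {poly L} (isPointed.Build {poly L} 0).
pose B : set_system I := [set S | exists2 q : {poly L}, q != 0 &
  forall p : {poly L}, p != 0 -> q %| p -> S p].
have FB : ProperFilter B.
  split; first by case=> q q0 /(_ q q0 (dvdpp q)).
  split.
  - by exists 1; rewrite ?oner_eq0.
  - move=> S T [p p0 HS] [q q0 HT]; exists (p * q); first by rewrite mulf_neq0.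
    move=> r r0 dr; split; [apply: HS|apply: HT] => //; apply: dvdp_trans dr.
      exact: dvdp_mulr.
    exact: dvdp_mull.
  - by move=> S T ST [q q0 HS]; exists q => // p p0 /HS-/(_ p0)/ST.
have [U [UU BU]] := ultraFilterLemma FB.
have nr (p : {poly L}) : exists x, p != 0 -> ~~ root (map_poly j p) x.
  have [->|p0] := eqVneq p 0; first by exists 0.
  have /closed_nonrootP[x Hx] : map_poly j p != 0 by rewrite map_poly_eq0.
  by exists x.
pose pt (p : I) : Omega := projT1 (cid (nr p)).
have ptP (p : I) : p != 0 -> ~~ root (map_poly j p) (pt p) := projT2 (cid (nr p)).
pose W : closedFieldType := ultrapower Omega UU.
pose g (p : {poly L}) : W := \pi_(ultrapower Omega UU) (fun i : I => (map_poly j p).[pt i]).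
have gadd : zmod_morphism g.
  move=> p q; rewrite -rmorphB; congr (\pi_ _ _); apply/funext => i.
  by rewrite rmorphB /= hornerD hornerN.
have gmul : monoid_morphism g.
  split=> [|p q].
    rewrite -(rmorph1 \pi_(ultrapower Omega UU)); congr (\pi_ _ _); apply/funext => i.
    by rewrite rmorph1 hornerC.
  rewrite -rmorphM; congr (\pi_ _ _); apply/funext => i.
  by rewrite rmorphM /= hornerM.
pose A := GRing.isZmodMorphism.Build _ _ g gadd.
pose M := GRing.isMonoidMorphism.Build _ _ g gmul.
pose G : {rmorphism {poly L} -> W} := HB.pack g A M.
have Ginj : injective G.
  apply: raddf_inj => p; apply: contra_eqP => /eqP p0.
  have UF := @ultra_proper _ _ UU.
  rewrite -(rmorph0 \pi_(ultrapower Omega UU)); apply/negP => /(ultrapower_eqP UU) H.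
  have /BU H' : B [set i : I | (map_poly j p).[pt i] != 0].
    exists p => // q q0 pq /=; have := ptP q q0; apply: contra => r0.
    by rewrite /root -{1}(divpK pq) rmorphM /= hornerM (eqP r0) mulr0.
  apply: (@filter_not_empty _ U); apply: filterS2 H H' => i /= ->.
  by rewrite eqxx.
have [h _] := fraction_lift Ginj.
by exists W; constructor.
Qed.

End ClosedExtension.

(** * Rational functions regular at 0 and 1 *)

Lemma map_mx_injective (R S : Type) (f : R -> S) k l : injective f ->
  injective (@map_mx R S f k l).
Proof.
move=> finj X Y /matrixP XY; apply/matrixP => i j; apply: finj.
by have := XY i j; rewrite !mxE.
Qed.

(** Any field of fractions of L[t] can play the role of Lt. *)

Section PrimitiveVectors.
Variables (L Lt : fieldType) (iota : {rmorphism {poly L} -> Lt}).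
Hypothesis iota_inj : injective iota.
Hypothesis iota_frac : forall x : Lt, exists a b : {poly L}, b != 0 /\ x = iota a / iota b.
Local Notation "p %:F" := (iota p).

Lemma iota_eq0 p : (iota p == 0) = (p == 0).
Proof. by rewrite -(inj_eq iota_inj) rmorph0. Qed.

Lemma common_denominator (T : finType) (P : {poly L} -> Prop) (v : T -> Lt) :
  P 1 -> (forall a b, P a -> P b -> P (a * b)) ->
  (forall t, exists a b, P b /\ v t * b%:F = a%:F) ->
  exists d (w : T -> {poly L}), P d /\ forall t, v t * d%:F = (w t)%:F.
Proof.
move=> P1 PM H.
have [ab abP] := choice (fun t => let: ex_intro a (ex_intro b h) := H t in
  ex_intro (fun ab => P ab.2 /\ v t * ab.2%:F = ab.1%:F) (a, b) h).
exists (\prod_t (ab t).2), (fun t => (ab t).1 * \prod_(s | s != t) (ab s).2).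
split=> [|t]; first by elim/big_ind: _ => // s _; case: (abP s).
by rewrite (bigD1 t) //= !rmorphM /= mulrA (abP t).2.
Qed.

(** A nonzero combination of least degree divides all members of the family, since
    the remainders of the division by it are combinations too. *)
Lemma bezout_family (T : finType) (w : T -> {poly L}) : (exists t, w t != 0) ->
  exists g (z : T -> {poly L}), [/\ g != 0, \sum_t z t * w t = g & forall t, g %| w t].
Proof.
move=> [t0 wt0].
pose S k := `[< exists z : T -> {poly L},
  \sum_t z t * w t != 0 /\ size (\sum_t z t * w t) = k >].
have exS : exists k, S k.
  exists (size (w t0)); apply/asboolP; exists (fun t => (t == t0)%:R).
  by rewrite (bigD1 t0) //= eqxx mul1r big1 ?addr0 // => t /negPf ->; rewrite mul0r.
case: (ex_minnP exS) => k /asboolP[z [g0 gk]] kmin.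
set g := \sum_t z t * w t in g0 gk; exists g, z; split=> // t.
rewrite /dvdp; apply: contraT => r0.
have rE : w t %% g = \sum_s ((s == t)%:R - (w t %/ g) * z s) * w s.
  under eq_bigr do rewrite mulrBl -mulrA.
  rewrite sumrB -mulr_sumr -/g (bigD1 t) //= eqxx mul1r big1; last first.
    by move=> s /negPf ->; rewrite mul0r.
  by rewrite addr0 {2}(divp_eq (w t) g) addrC addKr.
have : (k <= size (w t %% g)%R)%N.
  apply: kmin; apply/asboolP; exists (fun s => (s == t)%:R - (w t %/ g) * z s).
  by rewrite -rE.
by rewrite -gk leqNgt ltn_modp g0.
Qed.

Lemma primitive_vector (T : finType) (v : T -> Lt) : (exists t, v t != 0) ->
  exists c (w z : T -> {poly L}),
    [/\ c != 0, forall t, c * v t = (w t)%:F & \sum_t z t * w t = 1].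
Proof.
move=> [t0 vt0].
have [||| d [w [d0 wE]]] := @common_denominator T (fun d => d != 0) v.
- exact: oner_neq0.
- by move=> a b a0 b0; apply: mulf_neq0.
- move=> t; have [a [b [b0 ->]]] := iota_frac (v t); exists a, b.
  by split; [exact: b0 | rewrite divfK ?iota_eq0].
have [|g [z [g0 gE gw]]] := @bezout_family T w.
  by exists t0; rewrite -iota_eq0 -wE mulf_neq0 // iota_eq0.
have gF0 : g%:F != 0 by rewrite iota_eq0.
exists (d%:F / g%:F), (fun t => w t %/ g), z; split=> [|t|].
- by rewrite mulf_neq0 ?invr_eq0 ?iota_eq0.
- apply: (mulIf gF0); rewrite -rmorphM /= divpK // mulrAC divfK // mulrC.
  exact: wE.
apply: (mulIf g0); rewrite mul1r -[RHS]gE mulr_suml; apply: eq_bigr => t _.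
by rewrite -mulrA divpK.
Qed.

Definition nz01 (p : {poly L}) : Prop := p.[0] != 0 /\ p.[1] != 0.

Lemma nz01M p r : nz01 p -> nz01 r -> nz01 (p * r).
Proof. by move=> [p0 p1] [r0 r1]; rewrite /nz01 !hornerM !mulf_neq0. Qed.

Lemma nz01_1 : nz01 1.
Proof. by rewrite /nz01 !hornerC oner_eq0. Qed.

Lemma nz01_neq0 p : nz01 p -> p%:F != 0.
Proof. by case=> + _; rewrite iota_eq0; apply: contra_neq => ->; rewrite horner0. Qed.

Definition regular (x : Lt) : Prop := exists p r : {poly L}, nz01 r /\ x * r%:F = p%:F.

Lemma regular_poly p : regular p%:F.
Proof. by exists p, 1; split; [exact: nz01_1 | rewrite rmorph1 mulr1]. Qed.

Lemma regularD x y : regular x -> regular y -> regular (x + y).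
Proof.
move=> [p [r [r0 xE]]] [p' [r' [r0' yE]]]; exists (p * r' + p' * r), (r * r').
split; first exact: nz01M.
by rewrite rmorphD !rmorphM /= -xE -yE; ring.
Qed.

Lemma regularM x y : regular x -> regular y -> regular (x * y).
Proof.
move=> [p [r [r0 xE]]] [p' [r' [r0' yE]]]; exists (p * p'), (r * r').
split; first exact: nz01M.
by rewrite !rmorphM /= -xE -yE; ring.
Qed.

Lemma regularN x : regular x -> regular (- x).
Proof.
by move=> [p [r [r0 xE]]]; exists (- p), r; rewrite rmorphN /= -xE mulNr.
Qed.

Lemma regularB x y : regular x -> regular y -> regular (x - y).
Proof. by move=> Hx Hy; apply: regularD Hx (regularN Hy). Qed.

Lemma regular_sum (T : Type) (s : seq T) (P : pred T) (f : T -> Lt) :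
  (forall t, P t -> regular (f t)) -> regular (\sum_(t <- s | P t) f t).
Proof.
move=> H; elim/big_ind: _ => // [|x y]; last exact: regularD.
by rewrite -(rmorph0 iota); apply: regular_poly.
Qed.

Lemma regular_inv p : nz01 p -> regular (p%:F)^-1.
Proof.
by move=> p0; exists 1, p; split=> //; rewrite rmorph1 mulVf ?nz01_neq0.
Qed.

(** Invertibility at 0 and 1 can be tested modulo the functions vanishing there. *)
Lemma regular_unit p y x : nz01 p -> y.[0] = 0 -> y.[1] = 0 -> regular x ->
  p%:F + y%:F * x != 0 /\ regular (p%:F + y%:F * x)^-1.
Proof.
move=> [p0 p1] y0 y1 [a [r [[r0 r1] xE]]].
have q0 : nz01 (p * r + y * a).
  by rewrite /nz01 !hornerD !hornerM y0 y1 !mul0r !addr0 !mulf_neq0.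
have rF : r%:F != 0 by apply: nz01_neq0.
have E : p%:F + y%:F * x = (p * r + y * a)%:F / r%:F.
  apply: (canRL (mulfK rF)); rewrite rmorphD !rmorphM /= -xE; ring.
split; first by rewrite E mulf_neq0 ?invr_eq0 // nz01_neq0.
rewrite E invf_div; apply: regularM; first exact: regular_poly.
exact: regular_inv.
Qed.

Definition regular_row n (v : 'rV[Lt]_n) := forall i, regular (v 0 i).

Lemma regular_rowD n (u v : 'rV[Lt]_n) :
  regular_row u -> regular_row v -> regular_row (u + v).
Proof. by move=> Hu Hv i; rewrite mxE; apply: regularD. Qed.

Lemma regular_rowZ n x (v : 'rV[Lt]_n) :
  regular x -> regular_row v -> regular_row (x *: v).
Proof. by move=> Hx Hv i; rewrite mxE; apply: regularM. Qed.

Lemma regular_row_poly n (w : 'rV[{poly L}]_n) : regular_row (map_mx iota w).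
Proof. by move=> i; rewrite mxE; apply: regular_poly. Qed.

Lemma regular_row_mul n k (v : 'rV[Lt]_n) (A : 'M[Lt]_(n, k)) :
  regular_row v -> (forall i j, regular (A i j)) -> regular_row (v *m A).
Proof. by move=> Hv HA j; rewrite mxE; apply: regular_sum => i _; apply: regularM. Qed.

End PrimitiveVectors.

Section Regularization.
Variables (L Lt : fieldType) (iota : {rmorphism {poly L} -> Lt}).
Hypothesis iota_inj : injective iota.
Hypothesis iota_frac : forall x : Lt, exists a b : {poly L}, b != 0 /\ x = iota a / iota b.
Variables (n : nat) (B : 'M[L]_n).
Hypotheses (two : (2 : L) != 0) (Bsym : B^T = B) (Bunit : B \in unitmx).
Local Notation "p %:F" := (iota p).
Local Notation regular := (regular iota).
Local Notation regular_row := (regular_row iota).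
Local Notation "A ^P" := (map_mx (@polyC L) A) (at level 8, format "A ^P").
Local Notation "A ^Q" := (map_mx iota A) (at level 8, format "A ^Q").
Local Notation BQ := (B^P)^Q.
Local Notation b := (bform BQ).
Local Notation q := (qvalue BQ).

Lemma two_Lt : (2 : Lt) != 0.
Proof. by rewrite -[2](rmorph_nat (iota \o @polyC L)) fmorph_eq0. Qed.

Lemma BQ_sym : BQ^T = BQ. Proof. by rewrite !map_trmx Bsym. Qed.

Lemma map_const_regular k l (A : 'M[L]_(k, l)) i j : regular ((A^P)^Q i j).
Proof. by rewrite !mxE; apply: regular_poly. Qed.

Lemma regular_bform u v : regular_row u -> regular_row v -> regular (b u v).
Proof.
move=> Hu Hv; rewrite /bform mxE; apply: regular_sum => j _; rewrite [v^T _ _]mxE.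
by apply: regularM => //; apply: regular_row_mul => // i k; apply: map_const_regular.
Qed.

(** Write v = w / e in lowest terms, with a Bezout relation w.z + e z0 = 1.  Then
    the vector u0 dual to z, or its projection u to the orthogonal complement of the
    vs, satisfies e b(v, u) = 1 - e z0: it pairs with v to a pole of the same order
    as that of v.  The reflection in y = v + l u sends v to a regular vector, where l
    is 1 at the points of {0, 1} at which v has a pole, and 0 at the others.  Indeed
    e q(y) is then invertible at 0 and 1, being 2 l + e c modulo e l. *)
Lemma remove_pole (I : finType) (P : pred I) (vs : I -> 'rV[Lt]_n)
    (ds : I -> {poly L}) (v : 'rV[Lt]_n) (c : {poly L}) :
  nz01 c -> q v = c%:F ->
  (forall i, P i -> [/\ regular_row (vs i), nz01 (ds i), q (vs i) = (ds i)%:F &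
                    b v (vs i) = 0]) ->
  (forall i j, P i -> P j -> i != j -> b (vs i) (vs j) = 0) ->
  exists y, [/\ q y != 0, forall i, P i -> b (vs i) y = 0 &
    regular_row (v *m refl BQ y)].
Proof.
move=> c0 qv Hvs orth.
have [|e' [w [z [e0 wE bez]]]] := @primitive_vector L Lt iota iota_inj iota_frac (option 'I_n)
    (fun o => if o is Some i then v 0 i else 1).
  by exists None; rewrite oner_eq0.
set e := w None.
have eE : e' = e%:F by rewrite -[e']mulr1; apply: (wE None).
pose w1 : 'rV[{poly L}]_n := \row_i w (Some i).
pose z1 : 'rV[{poly L}]_n := \row_i z (Some i).
have wv : e%:F *: v = w1^Q.
  by apply/rowP => i; rewrite !mxE -eE; apply: (wE (Some i)).
have eF0 : e%:F != 0 by rewrite -eE.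
pose z0 := z None.
have bez1 : w1 *m z1^T = (1 - e * z0)%:M.
  rewrite [LHS]mx11_scalar; congr _%:M; rewrite mxE -bez.
  rewrite (bigD1 None) //= mulrC addrAC subrr add0r.
  rewrite (reindex_omap Some id) /=; last by case.
  apply: eq_big => [i|i _]; first by apply/esym/eqP.
  by rewrite !mxE mulrC.
pose u0 : 'rV[Lt]_n := (z1 *m (invmx B)^P)^Q.
have u0r : regular_row u0 by apply: regular_row_poly.
have bvu0 : e%:F * b v u0 = (1 - e * z0)%:F.
  rewrite -bformZl wv /bform /u0 map_trmx -!map_mxM trmx_mul.
  rewrite (map_trmx (@polyC L)) trmx_inv Bsym -!mulmxA (mulmxA B^P) -map_mxM.
  by rewrite mulmxV // map_mx1 mul1mx bez1 mxE mxE mulr1n.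
pose u := u0 - \sum_(i | P i) (b u0 (vs i) / (ds i)%:F) *: vs i.
have ur : regular_row u.
  move=> i; rewrite mxE [X in _ + X]mxE summxE; apply: regularB => //.
  apply: regular_sum => j Pj; have [vr d0 qd _] := Hvs j Pj.
  rewrite mxE; apply: regularM => //; apply: regularM.
    exact: regular_bform.
  exact: regular_inv.
have uvs i : P i -> b u (vs i) = 0.
  move=> Pi; have [vr d0 qd _] := Hvs i Pi.
  rewrite bformDl bformNl bform_suml (bigD1 i) //= big1 => [|j /andP[Pj ji]].
    by rewrite addr0 bformZl -qvalueE qd divfK ?subrr // nz01_neq0.
  by rewrite bformZl orth // mulr0.
have vu : b v u = b v u0.
  rewrite bformDr bformNr bform_sumr big1 ?subr0 // => i Pi.
  by have [_ _ _ vvs] := Hvs i Pi; rewrite bformZr vvs mulr0.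
clearbody u u0; pose l : {poly L} := (e.[0] == 0)%:R *: (1 - 'X) + (e.[1] == 0)%:R *: 'X.
have l0 : l.[0] = (e.[0] == 0)%:R by rewrite !hornerE; ring.
have l1 : l.[1] = (e.[1] == 0)%:R by rewrite !hornerE; ring.
pose y := v + l%:F *: u.
pose N : Lt := e%:F * q y.
have qyE : q y = c%:F + 2 * l%:F * b v u + l%:F ^+ 2 * q u.
  rewrite /y qvalueE !(bformDl, bformDr, bformZl, bformZr) -!qvalueE qv.
  by rewrite (bformC u v) ?BQ_sym //; ring.
have NE : N = (2 * l + e * c)%:F + (e * l)%:F * (l%:F * q u - 2 * z0%:F).
  transitivity (e%:F * c%:F + 2 * l%:F * (e%:F * b v u) + e%:F * l%:F ^+ 2 * q u).
    by rewrite /N qyE; ring.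
  rewrite vu bvu0; ring.
have [N0 Nr] : N != 0 /\ regular N^-1.
  rewrite NE; apply: (regular_unit iota_inj).
  - have [c00 c01] := c0.
    rewrite /nz01 !hornerD !hornerM l0 l1 -[2](rmorph_nat (@polyC L)) !hornerC.
    split; [have [ea|ea] := eqVneq e.[0] 0 | have [ea|ea] := eqVneq e.[1] 0];
      by rewrite ?ea ?mul0r ?mulr0 ?addr0 ?add0r ?mulr1 ?mulf_neq0.
  - by rewrite hornerM l0; have [->|_] := eqVneq e.[0] 0; rewrite ?mul0r ?mulr0.
  - by rewrite hornerM l1; have [->|_] := eqVneq e.[1] 0; rewrite ?mul0r ?mulr0.
  apply: regularB; last first.
    by apply: regularM; rewrite -?[2](rmorph_nat iota); apply: regular_poly.
  by apply: regularM; [apply: regular_poly | apply: regular_bform].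
have qy0 : q y != 0 by apply: contra_neq N0; rewrite /N => ->; rewrite mulr0.
exists y; split=> //.
  move=> i Pi; have [_ _ _ vvs] := Hvs i Pi.
  rewrite /y bformDr bformZr !(bformC (vs i)) ?BQ_sym // vvs uvs //.
  by rewrite mulr0 addr0.
pose k := (c%:F - l%:F ^+ 2 * q u) / N.
have -> : v *m refl BQ y = - (l%:F *: u) - k *: (w1^Q + (e%:F * l%:F) *: u).
  rewrite refl_act.
  have -> : 2 * b v y / q y = 1 + k * e%:F.
    have -> : 2 * b v y = q y + (c%:F - l%:F ^+ 2 * q u).
      by rewrite qyE /y bformDr bformZr -qvalueE qv; ring.
    by rewrite mulrDl divff // /k /N invfM; congr (_ + _); field; rewrite qy0 eF0.
  rewrite -wv /y !scalerDr !scalerDl !scale1r !scalerA.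
  by apply/rowP => i; rewrite !mxE; ring.
have lr := regular_poly iota l; have er := regular_poly iota e.
have qur : regular (q u) by apply: regular_bform.
apply: regular_rowD; rewrite -scaleN1r; apply: regular_rowZ.
- by apply: regularN; rewrite -(rmorph1 iota); apply: regular_poly.
- exact: regular_rowZ.
- by apply: regularN; rewrite -(rmorph1 iota); apply: regular_poly.
apply: regular_rowZ.
  apply: regularM => //; apply: regularB; first exact: regular_poly.
  by rewrite expr2; do 2?apply: regularM.
apply: regular_rowD; first exact: regular_row_poly.
by apply: regular_rowZ => //; apply: regularM.
Qed.


(** Isometries remove the poles of the images of an orthogonal basis of constant
    vectors, one after the other: these images are orthogonal, with values that are
    units at 0 and 1, so remove_pole applies and keeps the earlier ones fixed. *)
Lemma regularize (h : 'M[Lt]_n) (m : {poly L}) : nz01 m -> sim BQ h m%:F ->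
  exists d (P : 'M[{poly L}]_n), nz01 d /\ sim B^P P (d ^+ 2 * m).
Proof.
move=> m01 hB; have [D [dd [Dd Du d0]]] := diagonalization two Bsym Bunit.
pose DQ := (D^P)^Q.
have DQd i j : b (row i DQ) (row j DQ) = (((dd 0 i) *+ (i == j))%:P)%:F.
  rewrite bform_row /DQ map_trmx -!map_mxM map_trmx -!map_mxM Dd !mxE.
  by rewrite -val_eqE.
have nzP a : a != 0 -> nz01 a%:P by move=> a0; rewrite /nz01 !hornerC.
suff H k : (k <= n)%N -> exists us, anisotropic_seq BQ us /\
    forall i : 'I_n, (i < k)%N -> regular_row (row i DQ *m (h *m prodrefl BQ us)).
  have [us [us0 Hus]] := H n (leqnn n).
  pose g := h *m prodrefl BQ us.
  have gB : sim BQ g m%:F.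
    rewrite -[m%:F]mulr1; apply: sim_comp => //.
    by apply: prodrefl_sim; rewrite ?two_Lt ?BQ_sym.
  have gr i j : regular (g i j).
    have -> : g = ((invmx D)^P)^Q *m (DQ *m g).
      by rewrite mulmxA /DQ -!map_mxM mulVmx // !map_mx1 mul1mx.
    rewrite mxE; apply: regular_sum => l _; apply: regularM.
      exact: map_const_regular.
    have -> : (DQ *m g) l j = (row l DQ *m g) 0 j by rewrite -row_mul [RHS]mxE.
    exact: Hus.
  have [||| d [w [d01 wE]]] := @common_denominator L Lt iota ('I_n * 'I_n)%type (@nz01 L)
      (fun ij => g ij.1 ij.2).
  - exact: nz01_1.
  - by move=> ? ?; apply: nz01M.
  - by move=> [i j] /=; have [p [r [r0 rE]]] := gr i j; exists p, r.
  exists d, (\matrix_(i, j) w (i, j)); split=> //.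
  have E : (\matrix_(i, j) w (i, j))^Q = d%:F *: g.
    by clearbody g; apply/matrixP => i j; rewrite !mxE -(wE (i, j)) mulrC.
  have := simZ d%:F gB; rewrite -E /sim map_trmx -!map_mxM -rmorphXn -rmorphM -map_mxZ.
  exact: (map_mx_injective iota_inj).
elim: k => [|k IH] kn; first by exists [::].
have [us [us0 Hus]] := IH (ltnW kn).
pose g := h *m prodrefl BQ us; pose i0 := Ordinal kn.
have gB : sim BQ g m%:F.
  rewrite -[m%:F]mulr1; apply: sim_comp => //.
  by apply: prodrefl_sim; rewrite ?two_Lt ?BQ_sym.
have gb i j : b (row i DQ *m g) (row j DQ *m g) = (m * ((dd 0 i) *+ (i == j))%:P)%:F.
  by rewrite (simP BQ g m%:F).2 // DQd -rmorphM.
have [||||y [y0 Hy yr]] := @remove_pole 'I_n (fun i => i < k)%N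
    (fun i => row i DQ *m g) (fun i => m * (dd 0 i)%:P) (row i0 DQ *m g) (m * (dd 0 i0)%:P).
- exact/nz01M/nzP.
- by rewrite qvalueE gb eqxx.
- move=> i ik; split.
  + exact: Hus.
  + exact/nz01M/nzP.
  + by rewrite qvalueE gb eqxx.
  by rewrite gb -val_eqE /= gtn_eqF // mulr0n polyC0 mulr0 rmorph0.
- by move=> i j _ _ /negPf ij; rewrite gb ij mulr0n polyC0 mulr0 rmorph0.
exists (us ++ [:: y]); split; first by rewrite /anisotropic_seq all_cat; apply/and3P.
move=> i; rewrite ltnS leq_eqVlt prodrefl_cat /= mulmx1 (mulmxA h) mulmxA.
case/orP => [/eqP ik|ik]; first by have -> : i = i0 by apply: val_inj.
by rewrite refl_fix; [exact: Hus | exact: Hy].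
Qed.

End Regularization.

(** * Points of PSim^+ and R-links *)

Lemma sim_mult_inj (L : fieldType) n (B g : 'M[L]_n) c d : B \in unitmx ->
  (0 < n)%N -> sim B g c -> sim B g d -> c = d.
Proof.
move=> Bu n0; rewrite /sim => -> /eqP; rewrite -subr_eq0 -scalerBl scaler_eq0 subr_eq0.
case/orP => [/eqP //|/eqP B0]; move: Bu; rewrite B0 unitmxE.
by rewrite -(prednK n0) det0 unitr0.
Qed.

Lemma unit_neq0 (L : fieldType) n (B : 'M[L]_n) : (0 < n)%N -> B \in unitmx -> B != 0.
Proof.
by move=> n0; apply: contraTneq => ->; rewrite unitmxE -(prednK n0) det0 unitr0.
Qed.

(** An R-link may be normalized differently at 0 and at 1, whereas a single
    polynomial m is needed.  Take for P the entries of f without their common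
    factor: any other polynomial multiple of f is D P with a polynomial D, and D
    does not vanish where this multiple specializes to an invertible matrix. *)
Lemma primitive_family (L Lt : fieldType) (iota : {rmorphism {poly L} -> Lt}) n
    (B : 'M[L]_n) (f : 'M[Lt]_n) (mu : Lt) :
  injective iota ->
  (forall x, exists a b, b != 0 /\ x = iota a / iota b) ->
  (0 < n)%N -> B \in unitmx -> mu != 0 ->
  sim (map_mx iota (map_mx polyC B)) f mu ->
  exists (P : 'M[{poly L}]_n) (m : {poly L}), sim (map_mx polyC B) P m /\
    forall (a : L) (x : 'M[L]_n) (c : L) (s : Lt) (P' : 'M[{poly L}]_n),
      s *: f = map_mx iota P' -> map_mx (horner_eval a) P' = x ->
      sim B x c -> c != 0 -> exists2 r : L, r != 0 & m.[a] = r ^+ 2 * c.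
Proof.
move=> iinj ifrac n0 Bu mu0 fB.
have BQu : map_mx iota (map_mx polyC B) \in unitmx by rewrite -map_mx_comp map_unitmx.
have [k [l Bkl]] : exists k l, B k l != 0 by apply/matrix0Pn/unit_neq0.
have fn0 : exists kl : 'I_n * 'I_n, f kl.1 kl.2 != 0.
  have /(unit_neq0 n0)/matrix0Pn[k' [l' kl']] := sim_unit BQu mu0 fB.
  by exists (k', l').
have [s [w [z [s0 wE bez]]]] := primitive_vector iinj ifrac fn0.
pose P : 'M[{poly L}]_n := \matrix_(k, l) w (k, l).
have PE : map_mx iota P = s *: f.
  by apply/matrixP => k' l'; rewrite !mxE -(wE (k', l')).
pose m := ((B k l)^-1)%:P * (P *m map_mx polyC B *m P^T) k l.
have PfB := simZ s fB; rewrite -PE in PfB.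
have mE : iota m = s ^+ 2 * mu.
  have := PfB; rewrite /sim map_trmx -!map_mxM.
  move/matrixP/(_ k l); rewrite [LHS]mxE [RHS]mxE => E.
  rewrite /m rmorphM /= E 2![map_mx _ _ k l]mxE mulrCA -rmorphM -polyCM mulVf //.
  by rewrite !rmorph1 mulr1.
have PB : sim (map_mx polyC B) P m.
  move: PfB; rewrite -mE /sim map_trmx -!map_mxM -map_mxZ.
  exact: (map_mx_injective iinj).
exists P, m; split=> // a x c s' P' P'E P'a xB c0.
pose D := \sum_kl z kl * P' kl.1 kl.2.
have DE : iota D = s' / s.
  transitivity (\sum_kl iota (z kl) * (s' * f kl.1 kl.2)).
    rewrite rmorph_sum; apply: eq_bigr => kl _; rewrite rmorphM /=.
    have := congr1 (fun M : 'M_n => M kl.1 kl.2) P'E.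
    by rewrite /= !mxE => ->.
  transitivity (s' / s * iota (\sum_kl z kl * w kl)); last first.
    by rewrite bez rmorph1 mulr1.
  rewrite rmorph_sum mulr_sumr; apply: eq_bigr => kl _.
  by rewrite rmorphM /= -wE; field.
have P'P : P' = D *: P.
  apply: (map_mx_injective iinj); rewrite map_mxZ /= DE -P'E PE scalerA.
  by rewrite divfK.
have xE : x = D.[a] *: map_mx (horner_eval a) P by rewrite -P'a P'P map_mxZ.
have Da0 : D.[a] != 0.
  have /(unit_neq0 n0) := sim_unit Bu c0 xB; apply: contra_neq => Da.
  by rewrite xE Da scale0r.
exists D.[a]^-1; first by rewrite invr_eq0.
have := simZ D.[a] (sim_eval a PB); rewrite -xE => xB'.
by rewrite (sim_mult_inj Bu n0 xB xB') mulrA -exprMn mulVf // expr1n mul1r.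
Qed.

Lemma tofrac_inj (L : fieldType) : injective (@tofrac {poly L}).
Proof. by move=> p q /eqP; rewrite tofrac_eq => /eqP. Qed.

Section Points.
Variables (K : fieldType) (n : nat) (A : 'M[K]_n).
Hypotheses (two : (2 : K) != 0) (Asym : A^T = A) (Aunit : A \in unitmx).
Hypothesis n_gt0 : (0 < n)%N.

Lemma two_ext (L : fieldType) (i : {rmorphism K -> L}) : (2 : L) != 0.
Proof. by rewrite -[2](rmorph_nat i) fmorph_eq0. Qed.

Lemma sym_ext (L : fieldType) (i : {rmorphism K -> L}) : (map_mx i A)^T = map_mx i A.
Proof. by rewrite map_trmx Asym. Qed.

Lemma unit_ext (L : fieldType) (i : {rmorphism K -> L}) : map_mx i A \in unitmx.
Proof. by rewrite map_unitmx. Qed.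

Definition has_closed_ext (L : fieldType) : Prop :=
  exists Omega : closedFieldType, inhabited {rmorphism L -> Omega}.

(** Besides being proper, a point of the identity component comes with an
    algebraically closed extension of its field of definition; this condition is
    kept apart, and passes from L to L(t). *)
Lemma PSim_plusP (L : fieldType) (i : {rmorphism K -> L}) (g : 'M[L]_n) :
  PSim_plus A i g <-> has_closed_ext L /\
    exists c, [/\ c != 0, sim (map_mx i A) g c & proper g c].
Proof.
have SP (M : fieldType) (j : {rmorphism K -> M}) :=
  similitudeP (two_ext j) (sym_ext j) (unit_ext j).
split=> [[gS [Omega [j jg]]]|[[Omega [j]] [c [c0 gB gp]]]].
  split; first by exists Omega; constructor.
  have [c c0 gB] := (SP _ _ _).1 gS; exists c; split=> //.
  apply: (proper_map_inj (fmorph_inj j)).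
  apply: (proper_of_component (two_ext (j \o i)) (sym_ext (j \o i))
            (unit_ext (j \o i)) n_gt0 _ jg).
  by have := sim_map j gB; rewrite -map_mx_comp.
split; first by apply/SP; exists c.
exists Omega, j.
apply: (proper_component (two_ext (j \o i)) (sym_ext _) (unit_ext _) (c := j c)).
- by rewrite fmorph_eq0.
- by have := sim_map j gB; rewrite -map_mx_comp.
exact: proper_map.
Qed.

Variables (L : fieldType) (i : {rmorphism K -> L}).
Local Notation B := (map_mx i A).

Lemma path_link g h : has_closed_ext L -> path B g h -> R_link (PSim_plus A) i g h.
Proof.
move=> [Omega [j]] [P [m [PB Pp [m0 m1] P0 P1]]].
have ext : has_closed_ext L by exists Omega; constructor.
split.
- apply/PSim_plusP; split=> //; exists m.[0]; split=> //.
    by rewrite -P0; apply: sim_eval.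
  by rewrite -P0; apply: (proper_map (horner_eval 0)).
- apply/PSim_plusP; split=> //; exists m.[1]; split=> //.
    by rewrite -P1; apply: sim_eval.
  by rewrite -P1; apply: (proper_map (horner_eval 1)).
exists (map_mx (@tofrac {poly L}) P); split.
- apply/PSim_plusP; split.
    have [Omega' [j']] := closed_extension_ratfun j.
    by exists Omega'; constructor.
  exists (@tofrac {poly L} m); split.
  + by rewrite tofrac_eq0; apply: contra_neq m0 => ->; rewrite horner0.
  + by have := sim_map (@tofrac {poly L}) PB; rewrite -!map_mx_comp.
  exact: proper_map.
- by exists 1; [exact: oner_neq0 | exists P; [rewrite scale1r|]].
- by exists 1; [exact: oner_neq0 | exists P; [rewrite scale1r|]].
Qed.

Lemma chain_R_equivalent g h : has_closed_ext L -> chain B g h ->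
  R_equivalent (PSim_plus A) i g h.
Proof.
move=> ext; elim=> [x y xy|x|x y _|x y z _ xy _ yz].
- exact/rst_step/path_link.
- exact: rst_refl.
- exact: rst_sym.
- exact: rst_trans xy yz.
Qed.

Lemma link_poly g h c d : R_link (PSim_plus A) i g h ->
  sim B g c -> sim B h d -> c != 0 -> d != 0 ->
  exists (P : 'M[{poly L}]_n) (m : {poly L}) (a e : L),
    [/\ sim (map_mx polyC B) P m, a != 0, e != 0,
        m.[0] = a ^+ 2 * c & m.[1] = e ^+ 2 * d].
Proof.
move=> [gG hG [f [fG [s0 s00 [P0 f0 P0E]] [s1 s10 [P1 f1 P1E]]]]] gB hB c0 d0.
have [_ [mu [mu0 fB _]]] := (PSim_plusP _ _).1 fG.
have BE : map_mx (@tofrac {poly L} \o (@polyC L \o i)) A =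
          map_mx (@tofrac {poly L}) (map_mx polyC B) by rewrite -!map_mx_comp.
rewrite BE in fB.
have [P [m [PB H]]] := primitive_family (@tofrac_inj L) (@fraction_quotient {poly L})
  n_gt0 (unit_ext i) mu0 fB.
have [a a0 ma] := H 0 g c s0 P0 f0 P0E gB c0.
have [e e0 me] := H 1 h d s1 P1 f1 P1E hB d0.
by exists P, m, a, e.
Qed.

End Points.

(** * Comparing two forms with the same multipliers *)

Section Transfer.
Variables (K : fieldType) (n m : nat) (A : 'M[K]_n) (B : 'M[K]_m).
Hypotheses (two : (2 : K) != 0).
Hypotheses (Asym : A^T = A) (Aunit : A \in unitmx) (n_gt0 : (0 < n)%N).
Hypotheses (Bsym : B^T = B) (Bunit : B \in unitmx) (m_gt0 : (0 < m)%N).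
Hypothesis mult : forall (L : fieldType) (i : {rmorphism K -> L}) (c : L), c != 0 ->
  (exists g, sim (map_mx i A) g c) <-> (exists g, sim (map_mx i B) g c).
Variables (L : fieldType) (i : {rmorphism K -> L}).

Local Notation AL := (map_mx i A).
Local Notation BL := (map_mx i B).
Local Notation "A ^P" := (map_mx (@polyC L) A) (at level 8, format "A ^P").
Local Notation "A ^Q" := (map_mx (@tofrac {poly L}) A) (at level 8, format "A ^Q").

Lemma chain_mult (x y : 'M[L]_m) c : c != 0 -> sim BL x c -> proper x c ->
  sim BL y c -> proper y c -> chain BL x y.
Proof. exact: (chain_same_multiplier (two_ext two i) (sym_ext Bsym i) (unit_ext Bunit i)). Qed.

(** The multipliers along the link from g to h form a polynomial mu, which is also
    a multiplier of B over L(t).  A similitude of B with this multiplier, made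
    regular and proper, is a path between multiples of x and y, up to similitudes
    with the same multipliers. *)
Lemma transfer_link g h c d x y : R_link (PSim_plus A) i g h ->
  sim AL g c -> sim AL h d -> c != 0 -> d != 0 ->
  sim BL x c -> proper x c -> sim BL y d -> proper y d -> chain BL x y.
Proof.
move=> gh gA hA c0 d0 xB xp yB yp.
have [P [mu [a [e [PA a0 e0 mu0 mu1]]]]] := link_poly two Asym Aunit n_gt0 gh gA hA c0 d0.
have mu01 : nz01 mu by rewrite /nz01 mu0 mu1 !mulf_neq0 ?expf_neq0.
have [q qB] : exists q, sim ((BL^P)^Q) q (@tofrac {poly L} mu).
  have [H _] := @mult {fraction {poly L}} (@tofrac {poly L} \o (@polyC L \o i))
    (@tofrac {poly L} mu) (nz01_neq0 (@tofrac_inj L) mu01).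
  have [|q qB] := H.
    by exists P^Q; have := sim_map (@tofrac {poly L}) PA; rewrite -!map_mx_comp.
  by exists q; move: qB; rewrite -!map_mx_comp.
have two' := two_ext two i; have Bsym' := sym_ext Bsym i; have Bunit' := unit_ext Bunit i.
have [r [Q [[r0 r1] QB]]] := regularize (@tofrac_inj L) (@fraction_quotient {poly L})
  two' Bsym' Bunit' mu01 qB.
have m0 : (r ^+ 2 * mu).[0] = (r.[0] * a) ^+ 2 * c.
  by rewrite hornerM horner_exp mu0 exprMn mulrA.
have m1 : (r ^+ 2 * mu).[1] = (r.[1] * e) ^+ 2 * d.
  by rewrite hornerM horner_exp mu1 exprMn mulrA.
have ra0 : r.[0] * a != 0 by rewrite mulf_neq0.
have re0 : r.[1] * e != 0 by rewrite mulf_neq0.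
(* a constant reflection makes the whole family proper *)
have [Q' QB' Qp'] : exists2 Q', sim BL^P Q' (r ^+ 2 * mu) & proper Q' (r ^+ 2 * mu).
  have [rf rfB Hrf] := make_proper two' Bsym' Bunit' m_gt0.
  have [p0|p0] := Hrf _ _ (sim_eval 0 QB).
    by exists Q => //; apply: (proper_at0 two' Bunit' QB); rewrite // m0 mulf_neq0 ?expf_neq0.
  have QrB : sim BL^P (Q *m rf^P) (r ^+ 2 * mu).
    by rewrite -[r ^+ 2 * mu]mulr1; apply: sim_comp => //; rewrite -[1]/(1%:P); apply: sim_map.
  exists (Q *m rf^P) => //; apply: (proper_at0 two' Bunit' QrB).
    by rewrite m0 mulf_neq0 ?expf_neq0.
  by rewrite map_mxM /= eval_polyC.
pose x' := map_mx (horner_eval 0) Q'; pose y' := map_mx (horner_eval 1) Q'.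
have x'B : sim BL x' ((r.[0] * a) ^+ 2 * c) by rewrite -m0; apply: sim_eval.
have y'B : sim BL y' ((r.[1] * e) ^+ 2 * d) by rewrite -m1; apply: sim_eval.
have x'p : proper x' ((r.[0] * a) ^+ 2 * c).
  by rewrite -m0; apply: (proper_map (horner_eval 0)).
have y'p : proper y' ((r.[1] * e) ^+ 2 * d).
  by rewrite -m1; apply: (proper_map (horner_eval 1)).
have scale (s : L) z b w : s != 0 -> b != 0 -> sim BL z b -> proper z b ->
    sim BL w (s ^+ 2 * b) -> proper w (s ^+ 2 * b) -> chain BL z w.
  move=> s0 b0 zB zp wB wp.
  apply: (rst_trans _ _ _ (s *: z)); first exact/rst_step/(path_scale b0).
  have sb0 : s ^+ 2 * b != 0 by rewrite mulf_neq0 ?expf_neq0.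
  by apply: (chain_mult sb0) => //; [apply: simZ | apply: properZ].
apply: (rst_trans _ _ _ x'); first exact: scale ra0 c0 xB xp x'B x'p.
apply: (rst_trans _ _ _ y'); last first.
  by apply: rst_sym; apply: scale re0 d0 yB yp y'B y'p.
apply: rst_step; exists Q', (r ^+ 2 * mu); split=> //.
by rewrite m0 m1 !mulf_neq0 ?expf_neq0.
Qed.

Lemma proper_mult (c : L) : c != 0 -> (exists g, sim AL g c) ->
  exists2 x, sim BL x c & proper x c.
Proof.
move=> c0 /(mult i c0)[x xB].
exact: (sim_proper (two_ext two i) (sym_ext Bsym i) (unit_ext Bunit i) m_gt0 xB).
Qed.

(** The intermediate points of a chain have to be lifted to B as well, which is
    possible because they remain in PSim^+(A). *)
Lemma transfer_equivalent g h : R_equivalent (PSim_plus A) i g h ->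
  (PSim_plus A i g <-> PSim_plus A i h) /\
  forall c d x y, PSim_plus A i g -> sim AL g c -> sim AL h d -> c != 0 -> d != 0 ->
    sim BL x c -> proper x c -> sim BL y d -> proper y d -> chain BL x y.
Proof.
elim=> [g1 h1 gh|g1|g1 h1 _ [e IH]|g1 k1 h1 _ [e1 IH1] _ [e2 IH2]].
- split; first by case: gh.
  by move=> c d x y _; apply: transfer_link.
- split=> // c d x y gG gA gA' c0 d0.
  by rewrite -(sim_mult_inj (unit_ext Aunit i) n_gt0 gA gA'); apply: chain_mult.
- split; first by split; apply e.
  move=> c d x y hG hA gA c0 d0 xB xp yB yp; apply: rst_sym.
  exact: (IH d c y x (e.2 hG) gA hA).
split; first by split=> [/e1/e2|/e2/e1].
move=> c d x y gG gA hA c0 d0 xB xp yB yp.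
have kG : PSim_plus A i k1 by apply/e1.
have [_ [b [b0 kA _]]] := (PSim_plusP two Asym Aunit n_gt0 i k1).1 kG.
have [z zB zp] : exists2 z, sim BL z b & proper z b.
  by apply: proper_mult => //; exists k1.
apply: (rst_trans _ _ _ z).
  exact: IH1 gG gA kA c0 b0 xB xp zB zp.
exact: IH2 kG kA hA b0 d0 zB zp yB yp.
Qed.

End Transfer.

Lemma transfer_rationally_connected (K : fieldType) (n m : nat) (A : 'M[K]_n) (B : 'M[K]_m) :
  (2 : K) != 0 -> A^T = A -> A \in unitmx -> (0 < n)%N ->
  B^T = B -> B \in unitmx -> (0 < m)%N ->
  (forall (L : fieldType) (i : {rmorphism K -> L}) (c : L), c != 0 ->
    (exists g, sim (map_mx i A) g c) <-> (exists g, sim (map_mx i B) g c)) ->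
  rationally_connected (PSim_plus A) -> rationally_connected (PSim_plus B).
Proof.
move=> two As Au n0 Bs Bu m0 mult RA L i x y xG yG.
have [ext [c [c0 xB xp]]] := (PSim_plusP two Bs Bu m0 i x).1 xG.
have [_ [d [d0 yB yp]]] := (PSim_plusP two Bs Bu m0 i y).1 yG.
have mult' (M : fieldType) (j : {rmorphism K -> M}) (a : M) : a != 0 ->
    (exists g, sim (map_mx j B) g a) <-> (exists g, sim (map_mx j A) g a).
  by move=> a0; split=> /(mult M j a a0).
have [g gA gp] := proper_mult two As Au n0 mult' c0 (ex_intro _ x xB).
have [h hA hp] := proper_mult two As Au n0 mult' d0 (ex_intro _ y yB).
have gG : PSim_plus A i g by apply/PSim_plusP => //; split=> //; exists c.
have hG : PSim_plus A i h by apply/PSim_plusP => //; split=> //; exists d.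
apply: (chain_R_equivalent two Bs Bu m0 ext).
have [_ H] := transfer_equivalent two As Au n0 Bs Bu m0 mult (RA L i g h gG hG).
exact: H gG gA hA c0 d0 xB xp yB yp.
Qed.

Theorem theorem1 (K : fieldType) (n m : nat) (phi : 'M[K]_n) (psi : 'M[K]_m) :
  2 \notin [pchar K] ->
  (0 < n)%N -> nondeg_qform phi ->
  odd m -> nondeg_qform psi ->
  rationally_connected (PSim_plus (phi *t psi)) <->
  rationally_connected (PSim_plus phi).
Proof.
move=> char2 n_gt0 [phis phiu] odd_m [psis psiu].
have two : (2 : K) != 0 by move: char2; rewrite inE.
have nm_gt0 : (0 < n * m)%N by rewrite muln_gt0 n_gt0 odd_gt0.
have ts : (phi *t psi)^T = phi *t psi by rewrite trmx_tens phis psis.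
have tu : phi *t psi \in unitmx by apply: unitmx_tens.
have mult (L : fieldType) (i : {rmorphism K -> L}) (c : L) : c != 0 ->
    (exists g, sim (map_mx i (phi *t psi)) g c) <-> (exists g, sim (map_mx i phi) g c).
  move=> c0; rewrite map_mxT; apply: sim_odd_factor; rewrite ?map_unitmx //.
  - exact: (two_ext two i).
  - exact: (sym_ext phis i).
  - exact: (sym_ext psis i).
split; apply: transfer_rationally_connected => // L i c c0.
by split=> /(mult L i c c0).
Qed.
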